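(* Let $(H_n)_{n\in\mathbb N}$ be a sequence of Hilbert spaces and let $\boldsymbol y=(y_n)_{n\in\mathbb N}\in\times_{n\in\mathbb N}H_n$ be a $C_0$-sequence. For each $n\in\mathbb N$, let $\mathcal T_n=(T_n(t))_{t\ge0}\subset\mathcal L(H_n)$ be a semigroup. Then $\bigotimes_{n\in\mathbb N}^{\boldsymbol y}\mathcal T_n\subset\mathcal L\bigl(\bigotimes_{n\in\mathbb N}^{\boldsymbol y}H_n\bigr)$ is a nonzero semigroup if and only if there exists $\tau>0$ such that, for all $t\in[0,\tau]$, (i) $T_n(t)\ne0$ for all $n\in\mathbb N$; (ii) $\prod_{n\in\mathbb N}\max\{1,\|T_n(t)\|\}<\infty$; and (iii) $\sum_{n\in\mathbb N}|1-\langle T_n(t)y_n,y_n\rangle|<\infty$. If (i), (ii) and (iii) hold (for all $t\in[0,\tau]$), then, for every $t>0$, $\bigotimes_{n\in\mathbb N}^{\boldsymbol y}T_n(t)=\widehat\bigotimes_{n\in\mathbb N}^{\boldsymbol y}T_n(t)$, $(T_n(t)y_n)_{n\in\mathbb N}$ is a $C_0$-sequence equivalent to $\boldsymbol y$, and moreover $$\Bigl\|\bigotimes_{n\in\mathbb N}^{\boldsymbol y}T_n(t)\Bigr\|=\prod_{n\in\mathbb N}\|T_n(t)\|.$$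
   Context: Hilbert spaces are complex; $\mathcal L(H)$ denotes the bounded operators on $H$. A semigroup is a family $\mathcal T=(T(t))_{t\ge0}\subset\mathcal L(H)$ with $T(0)=I$ and $T(s+t)=T(s)T(t)$ (no measurability or continuity assumed). It is nonzero if $T(t)\ne0$ for some $t>0$. Products: for $(z_n)\subset\mathbb C$, $\prod_nz_n$ converges unconditionally to $a\in\mathbb C$ if $\lim_{N\to\infty}\prod_{n=1}^Nz_{\sigma(n)}=a$ for every bijection $\sigma:\mathbb N\to\mathbb N$. Infinite products are understood unconditionally. $\prod_nz_n$ is quasi-convergent if $\prod_n|z_n|$ converges unconditionally to a finite value; its value is then the unconditional limit of $\prod_nz_n$ if it exists and $0$ otherwise. Tensor products of spaces: $(h_n)\in\times_nH_n$ is a $C$-sequence if $\prod_n\|h_n\|$ converges unconditionally to a finite value. For a $C$-sequence $(h_n)$ the elementary tensor $\bigotimes_nh_n$ is the functional $(f_n)\mapsto\prod_n\langle h_n,f_n\rangle$ (quasi-convergent product) on the set of $C$-sequences. The complete tensor product $\bigotimes_nH_n$ is the completion of the linear span of elementary tensors with inner product determined by $\langle\bigotimes_nh_n,\bigotimes_nf_n\rangle=\prod_n\langle h_n,f_n\rangle$. A $C$-sequence is a $C_0$-sequence if $\sum_n|1-\|h_n\||<\infty$; two $C_0$-sequences are equivalent if $\sum_n|1-\langle h_n,f_n\rangle|<\infty$ (an equivalence relation). For a $C_0$-sequence $\boldsymbol y$, the incomplete tensor product $\bigotimes_n^{\boldsymbol y}H_n$ is the closed linear span in $\bigotimes_nH_n$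 of the $\bigotimes_nh_n$ with $(h_n)$ a $C_0$-sequence equivalent to $\boldsymbol y$. Tensor products of operators $A_n\in\mathcal L(H_n)$: $\bigotimes_n^{\boldsymbol y}A_n$ is well-defined (factorwise sense) if for every elementary tensor $\bigotimes_nh_n\in\bigotimes_n^{\boldsymbol y}H_n$, $\bigotimes_nA_nh_n$ is an elementary tensor in $\bigotimes_n^{\boldsymbol y}H_n$, and $\bigotimes_nh_n\mapsto\bigotimes_nA_nh_n$ extends linearly to a bounded operator on $\bigotimes_n^{\boldsymbol y}H_n$. For finite $F\subset\mathbb N$ let $A_F^{(\boldsymbol y)}$ be the operator $(\bigotimes_{n\in F}A_n)\otimes I$ on $\bigotimes_n^{\boldsymbol y}H_n\simeq(\bigotimes_{n\in F}H_n)\otimes(\bigotimes_{n\notin F}^{(y_n)_{n\notin F}}H_n)$. $\widehat\bigotimes_n^{\boldsymbol y}A_n$ is well-defined (strong-limit sense) if the net $(A_F^{(\boldsymbol y)})_F$ over finite $F\subset\mathbb N$ ordered by inclusion converges strongly to a bounded operator, which is denoted $\widehat\bigotimes_n^{\boldsymbol y}A_n$. $\bigotimes_n^{\boldsymbol y}\mathcal T_n:=(\bigotimes_n^{\boldsymbol y}T_n(t))_{t\ge0}$; saying it is a semigroup includes that these operators are well-defined (factorwise) for all $t\ge0$. *)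

(* Defs.v *)
From HB Require Import structures.
From mathcomp Require Import all_boot all_order all_algebra sesquilinear finmap.
From mathcomp Require Import complex.
From mathcomp Require Import all_classical all_reals.
From mathcomp Require Import topology normedtype sequences.

Set Implicit Arguments.
Unset Strict Implicit.
Unset Printing Implicit Defensive.

Import Order.TTheory GRing.Theory Num.Theory.
Import numFieldNormedType.Exports.

Local Open Scope classical_set_scope.
Local Open Scope ring_scope.

(* [inner x y] is linear in x and conjugate-linear in y. *)
HB.mixin Record isHilbert (R : realType) H of CompleteNormedModule R[i] H := {
  inner : {dot H for (Num.conj : R[i] -> R[i])} ;
  sqr_norm_inner : forall x : H, `|x| ^+ 2 = inner x x
}.

#[short(type="hilbertType")]
HB.structure Definition Hilbert (R : realType) :=
  {H of CompleteNormedModule R[i] H & isHilbert R H}.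

Section products.
Variable K : numFieldType.

Definition uncond_prod (z : nat -> K) (a : K) : Prop :=
  forall sigma : nat -> nat, bijective sigma ->
    (\prod_(n < N) z (sigma n)) @[N --> \oo] --> a.

(* The value of a quasi-convergent product: 0 if there is no unconditional limit. *)
Definition qprod (z : nat -> K) : K := xget 0 [set a | uncond_prod z a].

Definition abs_summable (z : nat -> K) : Prop := cvgn [normed series z].

End products.

Definition lspan (K : numFieldType) (V : lmodType K) (S : set V) : set V :=
  [set v | exists (m : nat) (c : 'I_m -> K) (s : 'I_m -> V),
     (forall i, S (s i)) /\ v = \sum_(i < m) c i *: s i].

(* Operators on a closed subspace [V] of a Hilbert space are represented by
   functions on the whole space of which only the restriction to [V] matters. *)
Section operators.
Variables (R : realType) (H : hilbertType R).
Implicit Types (V : set H) (A : H -> H) (T : R -> H -> H).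

Definition bounded_op V A : Prop :=
  [/\ forall x, V x -> V (A x),
      forall (c : R[i]) x x', V x -> V x' -> A (c *: x + x') = c *: A x + A x' &
      exists M : R[i], forall x, V x -> `|A x| <= M * `|x|].

Definition nonzero_op V A : Prop := exists2 x, V x & A x != 0.

(* Norms in a normed module over [R[i]] are real elements of [R[i]]. *)
Definition opnorm V A : R :=
  sup [set complex.Re `|A x| | x in [set x | V x /\ `|x| <= 1]].

(* Only the values [T t] with [0 <= t] matter. *)
Definition semigroup V T : Prop :=
  [/\ forall t, 0 <= t -> bounded_op V (T t),
      forall x, V x -> T 0 x = x &
      forall s t, 0 <= s -> 0 <= t ->
        forall x, V x -> T (s + t) x = T s (T t x)].

Definition nonzero_semigroup V T : Prop :=
  semigroup V T /\ exists2 t, 0 < t & nonzero_op V (T t).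

End operators.

Section tensor_spaces.
Variables (R : realType) (H : nat -> hilbertType R).
Implicit Types h f y : forall n, H n.

Definition C_seq h : Prop := exists a : R[i], uncond_prod (fun n => `|h n|) a.

Definition C0_seq h : Prop := C_seq h /\ abs_summable (fun n => 1 - `|h n|).

Definition C0_equiv h f : Prop := abs_summable (fun n => 1 - inner (h n) (f n)).

Definition cseq : Type := {h : forall n, H n | C_seq h}.

Definition etensor h : cseq -> R[i]^o :=
  fun g => qprod (fun n => inner (h n) (sval g n)).

Definition tensor_span : set (cseq -> R[i]^o) :=
  lspan [set etensor h | h in C_seq].

(* The complete tensor product, i.e. a completion of [tensor_span] for the inner
   product determined by its values on elementary tensors: a Hilbert space in
   which [tensor_span] embeds linearly and isometrically with dense range. *)
Record complete_tensor := CompleteTensor {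
  ctensor_space :> hilbertType R ;
  ctensor_map : (cseq -> R[i]^o) -> ctensor_space ;
  ctensor_map_linear : forall (c : R[i]) F G, tensor_span F -> tensor_span G ->
    ctensor_map (c *: F + G) = c *: ctensor_map F + ctensor_map G ;
  ctensor_map_inner : forall h f, C_seq h -> C_seq f ->
    inner (ctensor_map (etensor h)) (ctensor_map (etensor f)) =
    qprod (fun n => inner (h n) (f n)) ;
  ctensor_map_dense : dense (ctensor_map @` tensor_span)
}.

Variable X : complete_tensor.

(* Meaningful when [h] is a C-sequence. *)
Definition tensor h : X := ctensor_map X (etensor h).

Definition incomplete_tensor y : set X :=
  closure (lspan [set tensor h | h in [set h | C0_seq h /\ C0_equiv h y]]).

Definition is_tensor_op y (A : forall n, H n -> H n) (B : X -> X) : Prop :=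
  bounded_op (incomplete_tensor y) B /\
  forall h, C_seq h -> incomplete_tensor y (tensor h) ->
    [/\ C_seq (fun n => A n (h n)),
        incomplete_tensor y (tensor (fun n => A n (h n))) &
        B (tensor h) = tensor (fun n => A n (h n))].

(* [B] is the operator acting as [A n] on the factors with index [n] in [F], and
   as the identity on the remaining ones; it is determined by its values on the
   elementary tensors that span the incomplete tensor product. *)
Definition is_local_tensor_op y (A : forall n, H n -> H n) (F : {fset nat})
    (B : X -> X) : Prop :=
  bounded_op (incomplete_tensor y) B /\
  forall h, C0_seq h -> C0_equiv h y ->
    B (tensor h) = tensor (fun n => if n \in F then A n (h n) else h n).

Definition fset_net : set_system {fset nat} :=
  filter_from setT (fun F0 : {fset nat} => [set F | (F0 `<=` F)%fset]).

Definition is_strong_tensor_op y (A : forall n, H n -> H n) (B : X -> X) : Prop :=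
  bounded_op (incomplete_tensor y) B /\
  exists AF : {fset nat} -> X -> X,
    (forall F, is_local_tensor_op y A F (AF F)) /\
    forall x, incomplete_tensor y x -> AF F x @[F --> fset_net] --> B x.

End tensor_spaces.

Arguments tensor {R H} X h.
Arguments incomplete_tensor {R H} X y.

(* Main.v *)
(* An unconditionally convergent product with nonzero value converges absolutely.
   Hence a C-sequence h whose tensor is a nonzero element of the incomplete tensor
   product V of y is a C_0-sequence equivalent to y, and V and its operators are
   determined by such h.

   If sum (max(1, |A_n|) - 1) < oo and (A_n y_n) is equivalent to y, then, applying
   Cauchy-Schwarz to the positive form |A_n|^2 <u, v> - <A_n u, A_n v>, (A_n h_n) is
   equivalent to y for every h equivalent to y. By Schur's product theorem, replacing
   one factor h_n by A_n h_n in a linear combination of elementary tensors increases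
   the norm by at most the factor |A_n|; since the tensor of (A_n h_n for n in F, h_n
   otherwise) tends to that of (A_n h_n) along finite F, the tensor product operator B
   exists, is the strong limit of its finite parts, and has norm at most
   prod_(n in F) |A_n| up to a factor tending to 1. Testing B on tensors that are
   near-maximizers for A_n in the coordinates n in F and y_n elsewhere gives the reverse
   inequality. The conditions are stable under composition, hence hold for all times.

   Conversely, if B <> 0, then some h has a nonzero image tensor (A_n h_n); changing
   h in finitely many coordinates and using that B is bounded bounds the products
   prod_(n in F) |A_n|, and (A_n y_n), (A_n h_n) and y are equivalent. *)

Require Import Defs.
From HB Require Import structures.
From mathcomp Require Import all_boot all_order all_algebra sesquilinear finmap.
From mathcomp Require Import complex.
From mathcomp Require Import all_classical all_reals.
From mathcomp Require Import topology normedtype sequences.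
From mathcomp Require Import ring lra.

Set Implicit Arguments.
Unset Strict Implicit.
Unset Printing Implicit Defensive.

Import Order.TTheory GRing.Theory Num.Theory.
Import numFieldNormedType.Exports.

Local Open Scope classical_set_scope.
Local Open Scope ring_scope.

(** * Norms and summability *)

(** Unconditional convergence speaks of permutations only, whereas every estimate below is along
    finite sets of indices. The passage back is the delicate one: if products over sets far out do
    not tend to 1, a permutation is built whose partial products fail to be Cauchy. For h equivalent
    to y the difference h - y is merely square summable, so the bound |A_n(h_n - y_n)| |A_n y_n| on
    the cross terms is not summable. The defect form repairs this, since its value |A_n|^2 |y_n|^2 -
    |A_n y_n|^2 is itself summable (with max(1, |A_n|) for |A_n|). The same form supplies one of the
    two positive matrices in Schur's theorem; the other is the Gram matrix of the tensors with the
    treated factor frozen. A C-sequence whose tensor is zero can lie in no class at all; its image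
    is handled through the products of norms alone. Nonvanishing of the factors does not survive
    composition, so only the other two conditions are carried to all times; nonvanishing is used at
    the single time tau, to exhibit a nonzero image. *)

Lemma cauchy_seq_cvg (K : numFieldType) (V : completeNormedModType K) (u : nat -> V) :
  (forall e : K, 0 < e -> exists N, forall n, (N <= n)%N -> `|u n - u N| <= e) ->
  cvgn u.
Proof.
move=> cu; apply/cauchy_cvgP/cauchy_exP => e e0.
have e20 : 0 < e / 2 by rewrite divr_gt0.
have [N HN] := cu _ e20; exists (u N); exists N => // n /= Nn.
rewrite -ball_normE /= distrC.
by apply: le_lt_trans (HN _ Nn) _; rewrite ltr_pdivrMr// ltr_pMr// ltr1n.
Qed.

Section real_norm.
Variable R : realType.
Local Notation C := R[i].
Local Notation re := complex.Re.
Local Notation im := complex.Im.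

(** Norms live in [R[i]], whose order is only partial; their real parts are open to real
    arithmetic. *)
Definition nrm (V : normedZmodType C) (x : V) : R := re `|x|.

Lemma nrmE (V : normedZmodType C) (x : V) : `|x| = (nrm x)%:C%C :> C.
Proof. by rewrite /nrm RRe_real// normr_real. Qed.

Lemma nrm_ge0 (V : normedZmodType C) (x : V) : 0 <= nrm x.
Proof. by have := normr_ge0 x; rewrite nrmE lecR. Qed.

Lemma nrm0 (V : normedZmodType C) : nrm (0 : V) = 0.
Proof. by rewrite /nrm normr0. Qed.

Lemma nrm_eq0 (V : normedZmodType C) (x : V) : (nrm x == 0) = (x == 0).
Proof. by rewrite -(normr_eq0 x) nrmE eq_complex /= eqxx andbT. Qed.

Lemma nrmD (V : normedZmodType C) (x x' : V) : nrm (x + x') <= nrm x + nrm x'.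
Proof. by have := ler_normD x x'; rewrite !nrmE -rmorphD/= lecR. Qed.

Lemma nrmN (V : normedZmodType C) (x : V) : nrm (- x) = nrm x.
Proof. by rewrite /nrm normrN. Qed.

Lemma nrmBC (V : normedZmodType C) (x x' : V) : nrm (x - x') = nrm (x' - x).
Proof. by rewrite /nrm distrC. Qed.

Lemma nrmB_le (V : normedZmodType C) (b a c : V) :
  nrm (a - c) <= nrm (a - b) + nrm (b - c).
Proof. by apply: le_trans (nrmD _ _); rewrite addrA subrK. Qed.

Lemma nrmZ (V : normedModType C) (c : C) (x : V) : nrm (c *: x) = nrm c * nrm x.
Proof. by rewrite {1}/nrm normrZ !nrmE -rmorphM. Qed.

Lemma nrm1 : nrm (1 : C) = 1.
Proof. by rewrite /nrm normr1. Qed.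

Lemma nrmM (a b : C) : nrm (a * b) = nrm a * nrm b.
Proof. by rewrite {1}/nrm normrM !nrmE -rmorphM. Qed.

Lemma nrm_prod (I : Type) (s : seq I) (z : I -> C) :
  nrm (\prod_(i <- s) z i) = \prod_(i <- s) nrm (z i).
Proof.
by elim: s => [|i s IH]; rewrite ?big_nil ?nrm1// !big_cons nrmM IH.
Qed.

Lemma nrm_sum (V : normedZmodType C) (I : Type) (s : seq I) (P : pred I) (x : I -> V) :
  nrm (\sum_(i <- s | P i) x i) <= \sum_(i <- s | P i) nrm (x i).
Proof.
elim: s => [|i s IH]; rewrite ?big_nil ?nrm0// !big_cons; case: (P i) => //.
by apply: le_trans (nrmD _ _) _; rewrite lerD2l.
Qed.

Lemma nrm_real (r : R) : nrm (r%:C%C : C) = `|r|.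
Proof. by rewrite /nrm normc_def /= expr0n addr0 sqrtr_sqr. Qed.

Lemma Re_nrm (z : C) : `|re z| <= nrm z.
Proof. by have := normc_ge_Re z; rewrite nrmE lecR. Qed.

Lemma nrmi : nrm ('i%C : C) = 1.
Proof. by rewrite /nrm normc_def /= expr0n expr1n add0r sqrtr1. Qed.

Lemma Im_nrm (z : C) : `|im z| <= nrm z.
Proof.
by have := Re_nrm (z * 'i%C); rewrite ReiNIm normrN nrmM nrmi mulr1.
Qed.

Lemma nrm_ReIm (z : C) : nrm z <= `|re z| + `|im z|.
Proof.
rewrite {1}[z]complexE; apply: le_trans (nrmD _ _) _.
by rewrite nrmM !nrm_real nrmi mul1r.
Qed.

Lemma nrm_conj (z : C) : nrm (Num.conj z) = nrm z.
Proof. by rewrite /nrm norm_conjC. Qed.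

Lemma cvg_nrmP (V : pseudoMetricNormedZmodType C) (T : Type) (F : set_system T)
    (FF : Filter F) (f : T -> V) (l : V) :
  f x @[x --> F] --> l <->
  forall e : R, 0 < e -> \forall x \near F, nrm (f x - l) <= e.
Proof.
split=> [/cvgrPdist_le fl e e0|fl].
  have e0' : 0 < e%:C%C by rewrite ltcR.
  move: (fl _ e0'); apply: filterS => x.
  by rewrite nrmE lecR nrmBC.
apply/cvgrPdist_le => e e0.
have e_real : e \is Num.real by rewrite gtr0_real.
move: e0; rewrite -(RRe_real e_real) ltcR => e0.
by move: (fl _ e0); apply: filterS => x; rewrite nrmE lecR nrmBC.
Qed.

Lemma cvgn_nrmP (V : pseudoMetricNormedZmodType C) (u : nat -> V) (l : V) :
  u n @[n --> \oo] --> l <->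
  forall e : R, 0 < e -> exists N, forall n, (N <= n)%N -> nrm (u n - l) <= e.
Proof.
rewrite cvg_nrmP; split=> ul e /ul.
  by move=> [N _ H]; exists N.
by move=> [N H]; exists N.
Qed.

Lemma nrm_cauchy_cvg (V : completeNormedModType C) (u : nat -> V) :
  (forall e : R, 0 < e -> exists N, forall n, (N <= n)%N -> nrm (u n - u N) <= e) ->
  exists l : V, u n @[n --> \oo] --> l.
Proof.
move=> cu; exists (lim (u @ \oo)); apply: cauchy_seq_cvg => e e0.
have e_real : e \is Num.real by rewrite gtr0_real.
move: e0; rewrite -(RRe_real e_real) ltcR => /cu [N HN].
by exists N => n /HN; rewrite nrmE lecR.
Qed.

Lemma complex_cauchy_cvg (u : nat -> C) :
  (forall e : R, 0 < e -> exists N, forall n, (N <= n)%N -> nrm (u n - u N) <= e) ->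
  exists l : C, forall e : R, 0 < e -> exists N, forall n, (N <= n)%N -> nrm (u n - l) <= e.
Proof.
move=> cu.
have reC : cvgn (fun n => re (u n) : R^o).
  apply: cauchy_seq_cvg => e /cu [N HN]; exists N => n /HN.
  by apply: le_trans; rewrite -raddfB Re_nrm.
have imC : cvgn (fun n => im (u n) : R^o).
  apply: cauchy_seq_cvg => e /cu [N HN]; exists N => n /HN.
  by apply: le_trans; rewrite -raddfB Im_nrm.
exists (lim ((fun n => re (u n) : R^o) @ \oo) +i* lim ((fun n => im (u n) : R^o) @ \oo))%C.
move=> e e0; have e20 : 0 < e / 2 by rewrite divr_gt0.
move/cvgrPdist_le : reC => /(_ _ e20) [N _ HN].
move/cvgrPdist_le : imC => /(_ _ e20) [M _ HM].
exists (maxn N M) => n; rewrite geq_max => /andP[/HN /= Hr /HM /= Hi].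
apply: le_trans (nrm_ReIm _) _; rewrite !raddfB /=.
by rewrite distrC [X in _ + X]distrC; lra.
Qed.

End real_norm.

(** * Finite index sets and initial segments *)

Lemma fset_split (K : Type) (idx : K) (op : Monoid.com_law idx)
    (A B : {fset nat}) (f : nat -> K) : (A `<=` B)%fset ->
  \big[op/idx]_(n <- B) f n =
  op (\big[op/idx]_(n <- A) f n) (\big[op/idx]_(n <- (B `\` A)%fset) f n).
Proof.
move=> AB; rewrite (big_fsetID _ (mem A)) /=; congr (_ _ _); apply: perm_big.
- apply: uniq_perm; rewrite ?fset_uniq// => n; rewrite !inE/=.
  by case: (boolP (n \in A)) => [/(fsubsetP AB)->|]; rewrite ?andbF.
- by apply: uniq_perm; rewrite ?fset_uniq// => n; rewrite !inE/= andbC.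
Qed.

Lemma sum_fset_split (V : nmodType) (A B : {fset nat}) (f : nat -> V) :
  (A `<=` B)%fset ->
  \sum_(n <- B) f n = \sum_(n <- A) f n + \sum_(n <- (B `\` A)%fset) f n.
Proof. exact: fset_split. Qed.

Lemma prod_fset_split (K : comNzRingType) (A B : {fset nat}) (f : nat -> K) :
  (A `<=` B)%fset ->
  \prod_(n <- B) f n = \prod_(n <- A) f n * \prod_(n <- (B `\` A)%fset) f n.
Proof. exact: fset_split. Qed.

Lemma fset_bound (A : {fset nat}) : exists N, forall n, n \in A -> (n < N)%N.
Proof.
exists (\max_(n <- A) n).+1 => n nA; rewrite ltnS.
by rewrite (big_fsetD1 n) //= leq_maxl.
Qed.

Definition fseg (N : nat) : {fset nat} := [fset n | n in iota 0 N]%fset.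

Lemma in_fseg N n : (n \in fseg N) = (n < N)%N.
Proof.
apply/imfsetP/idP => [[m /=]|nN]; first by rewrite mem_iota => mN ->.
by exists n => //=; rewrite mem_iota.
Qed.

Lemma big_fseg (K : Type) (idx : K) (op : Monoid.com_law idx) (f : nat -> K) N :
  \big[op/idx]_(n <- fseg N) f n = \big[op/idx]_(n < N) f n.
Proof.
rewrite -(big_mkord xpredT f) /=; apply: perm_big; apply: uniq_perm.
- exact: fset_uniq.
- exact: iota_uniq.
- by move=> n; rewrite in_fseg mem_index_iota.
Qed.

Lemma sum_fseg (V : nmodType) (f : nat -> V) N :
  \sum_(n <- fseg N) f n = \sum_(n < N) f n.
Proof. exact: big_fseg. Qed.

Lemma prod_fseg (K : comNzRingType) (f : nat -> K) N :
  \prod_(n <- fseg N) f n = \prod_(n < N) f n.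
Proof. exact: big_fseg. Qed.

Section summability.
Variable R : realType.
Implicit Types u v : nat -> R.

(** Bounded sums over finite sets, rather than a limit: no order of summation enters, and comparison
    is immediate. *)
Definition summable_seq u : Prop :=
  exists C : R, forall F : {fset nat}, \sum_(n <- F) `|u n| <= C.

Lemma summable_seqS u v (c : R) : (forall n, `|u n| <= c * `|v n|) ->
  summable_seq v -> summable_seq u.
Proof.
move=> uv [C vC]; exists (`|c| * C) => F.
apply: (@le_trans _ _ (\sum_(n <- F) `|c| * `|v n|)).
  by apply: ler_sum => n _; apply: le_trans (uv n) _; rewrite ler_wpM2r ?ler_norm.
by rewrite -mulr_sumr ler_wpM2l.
Qed.

Lemma summable_seq_le u v : (forall n, `|u n| <= v n) ->
  summable_seq v -> summable_seq u.
Proof.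
move=> uv; apply: (@summable_seqS _ _ 1) => n; rewrite mul1r.
by apply: le_trans (uv n) _; rewrite ler_norm.
Qed.

Lemma summable_seqD u v : summable_seq u -> summable_seq v ->
  summable_seq (fun n => u n + v n).
Proof.
move=> [C uC] [D vD]; exists (C + D) => F.
apply: (@le_trans _ _ (\sum_(n <- F) (`|u n| + `|v n|))).
  by apply: ler_sum => n _; apply: ler_normD.
by rewrite big_split lerD.
Qed.

Lemma summable_seqZ u (c : R) : summable_seq u -> summable_seq (fun n => c * u n).
Proof. by apply: (@summable_seqS _ _ `|c|) => n; rewrite normrM. Qed.

Lemma summable_seq_abs u : summable_seq u -> summable_seq (fun n => `|u n|).
Proof. by apply: (@summable_seqS _ _ 1) => n; rewrite normr_id mul1r. Qed.

Lemma summable_seq_bounded u : summable_seq u -> exists2 C, 0 <= C & forall n, `|u n| <= C.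
Proof.
move=> [C uC]; exists C => [|n].
  by have := uC fset0; rewrite big_seq_fset0.
by have := uC [fset n]%fset; rewrite big_seq_fset1.
Qed.

(** [F0] nearly attains the supremum of the finite sums, so a set disjoint from it can add at most
    [e]. *)
Lemma summable_seq_tail u (e : R) : summable_seq u -> 0 < e ->
  exists F0 : {fset nat}, forall F : {fset nat}, [disjoint F & F0]%fset ->
    \sum_(n <- F) `|u n| <= e.
Proof.
move=> [C uC] e0.
pose E := [set \sum_(n <- F : {fset nat}) `|u n| | F in setT].
have supE : has_sup E.
  split; first by exists (\sum_(n <- fset0 : {fset nat}) `|u n|), fset0.
  by exists C => _ [F _ <-].
have [_ [F0 _ <-] HF0] := sup_adherent e0 supE.
exists F0 => F FF0.
have : \sum_(n <- (F0 `|` F)%fset) `|u n| <= sup E.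
  by apply: ub_le_sup; [case: supE | exists (F0 `|` F)%fset].
rewrite (sum_fset_split _ (fsubsetUl F0 F)) fsetDUl fsetDv fset0U.
have -> : (F `\` F0 = F)%fset by apply/fsetDidPl.
by move: HF0; lra.
Qed.

Lemma abs_summableP (z : nat -> R[i]) :
  abs_summable z <-> summable_seq (fun n => nrm (z n)).
Proof.
have sumE N : \sum_(0 <= n < N) `|z n| = (\sum_(n < N) nrm (z n))%:C%C.
  by rewrite big_mkord rmorph_sum; apply: eq_bigr => i _; rewrite nrmE.
split.
  move=> /cvg_ex [l /cvgn_nrmP ul].
  have [N HN] := ul 1 ltr01; exists (complex.Re l + 1) => F.
  have [M FM] := fset_bound F.
  have FS : (F `<=` fseg (maxn M N))%fset.
    by apply/fsubsetP => n /FM nM; rewrite in_fseg (leq_trans nM)// leq_maxl.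
  have -> : \sum_(n <- F) `|nrm (z n)| = \sum_(n <- F) nrm (z n).
    by apply: eq_bigr => n _; rewrite ger0_norm ?nrm_ge0.
  apply: (@le_trans _ _ (\sum_(n <- fseg (maxn M N)) nrm (z n))).
    rewrite (sum_fset_split _ FS)/= lerDl; apply: sumr_ge0 => n _; exact: nrm_ge0.
  have := HN _ (leq_maxr M N); rewrite /series/= sumE => H; rewrite sum_fseg.
  have := le_trans (ler_norm _) (le_trans (Re_nrm _) H).
  by rewrite raddfB /= lerBlDl addrC.
move=> [C zC].
pose u N := \sum_(n < N) nrm (z n).
have u_nd : nondecreasing_seq u.
  apply/nondecreasing_seqP => N; rewrite /u big_ord_recr/= lerDl; exact: nrm_ge0.
have u_ub : has_ubound (range u).
  exists C => _ [N _ <-]; rewrite /u -(sum_fseg (fun n => nrm (z n))).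
  apply: le_trans (zC (fseg N)).
  by apply: ler_sum => n _; exact: ler_norm.
have [l ul] := (cvg_ex _).1 (nondecreasing_is_cvgn u_nd u_ub).
apply/cvg_ex; exists l%:C%C; apply/cvgn_nrmP => e e0.
move/cvgrPdist_le : ul => /(_ _ e0) [N _ HN]; exists N => n /HN /=.
by rewrite /series/= sumE -rmorphB nrm_real distrC.
Qed.

End summability.

(** * Unconditional products *)

(** For any permutation, the image of a long enough initial segment is a finite set containing [F0];
    the inverse [g] tells how long. *)
Lemma net_uncond_prod (K : numFieldType) (z : nat -> K) (p : K) :
  (forall e : K, 0 < e -> exists F0 : {fset nat}, forall F : {fset nat},
     (F0 `<=` F)%fset -> `|\prod_(n <- F) z n - p| <= e) ->
  uncond_prod z p.
Proof.
move=> zp sigma [g sK gK]; apply/cvgrPdist_le => e /zp [F0 HF0].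
have [N FN] := fset_bound [fset g n | n in F0]%fset.
exists N => // M /= NM.
pose F : {fset nat} := [fset sigma n | n in fseg M]%fset.
have FF : (F0 `<=` F)%fset.
  apply/fsubsetP => n nF0; apply/imfsetP; exists (g n); rewrite ?gK//= in_fseg.
  by apply: leq_trans NM; apply: FN; apply/imfsetP; exists n.
rewrite distrC; apply: le_trans (HF0 _ FF); rewrite le_eqVlt; apply/orP; left.
apply/eqP; congr (`|_ - _|).
rewrite -(big_mkord xpredT (fun n => z (sigma n))) -(big_map sigma xpredT).
apply: perm_big; apply: uniq_perm; rewrite ?fset_uniq//.
  by rewrite map_inj_uniq ?iota_uniq//; apply: can_inj sK.
move=> n; apply/mapP/imfsetP => -[m /= mM ->]; exists m => //=.
  by move: mM; rewrite in_fseg mem_index_iota.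
by move: mM; rewrite in_fseg mem_index_iota.
Qed.

Lemma uncond_prod_unique (K : numFieldType) (z : nat -> K) (a b : K) :
  uncond_prod z a -> uncond_prod z b -> a = b.
Proof.
move=> za zb; have bij : bijective (@id nat) by exists id.
exact: (cvg_unique _ (za _ bij) (zb _ bij)).
Qed.

Section complex_products.
Variable R : realType.
Local Notation C := R[i].
Implicit Types (z w : nat -> C) (p q : C) (F G : {fset nat}).

Definition near1 z : Prop := summable_seq (fun n => nrm (1 - z n)).

(** Setting the factors in [F] to 1 keeps the index set, so a tail is again a product over all
    naturals. *)
Definition off F (K : nzRingType) (z : nat -> K) : nat -> K :=
  fun n => if n \in F then 1 else z n.

(** The threshold 1/2 closes the induction: with d the new term and S the old sum, (1 + d) 2S + d <=
    2 (d + S) exactly when 2 d S <= d. *)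
Lemma prodB1_le (s : seq nat) z : \sum_(n <- s) nrm (1 - z n) <= 2^-1 ->
  nrm (\prod_(n <- s) z n - 1) <= 2 * \sum_(n <- s) nrm (1 - z n).
Proof.
elim: s => [|m s IH]; rewrite ?big_nil ?subrr ?nrm0 ?mulr0// !big_cons.
set S := \sum_(n <- s) _ in IH *; set P := \prod_(n <- s) _ in IH *.
set d := nrm (1 - z m) => dS.
have d0 : 0 <= d := nrm_ge0 _.
have S0 : 0 <= S by apply: sumr_ge0 => n _; exact: nrm_ge0.
have {}IH := IH ltac:(lra).
have -> : z m * P - 1 = z m * (P - 1) - (1 - z m) by ring.
apply: le_trans (nrmD _ _) _; rewrite nrmN -/d nrmM.
have zm : nrm (z m) <= 1 + d.
  have -> : z m = 1 - (1 - z m) by ring.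
  by apply: le_trans (nrmD _ _) _; rewrite nrmN nrm1.
have : nrm (z m) * nrm (P - 1) <= (1 + d) * (2 * S).
  by rewrite ler_pM ?nrm_ge0.
have : d * S <= d * 2^-1 by rewrite ler_wpM2l //; lra.
lra.
Qed.

Lemma near1_tail z (e : R) : near1 z -> 0 < e ->
  exists F0, forall F, [disjoint F & F0]%fset -> nrm (\prod_(n <- F) z n - 1) <= e.
Proof.
move=> zs e0; have e20 : 0 < Num.min (e / 2) 2^-1 by rewrite lt_min; apply/andP; lra.
have [F0 HF0] := summable_seq_tail zs e20; exists F0 => F /HF0.
rewrite (eq_bigr (fun n => nrm (1 - z n))); last first.
  by move=> n _; rewrite ger0_norm// nrm_ge0.
by rewrite le_min => /andP[H1 /prodB1_le H2]; lra.
Qed.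

Lemma near1_prod_bounded z : near1 z ->
  exists2 D : R, 0 < D & forall F, nrm (\prod_(n <- F) z n) <= D.
Proof.
move=> zs; have [F0 HF0] := near1_tail zs ltr01.
have ge1 G : 1 <= \prod_(n <- G) (1 + nrm (z n)).
  apply: (@le_trans _ _ (\prod_(n <- G) 1)); first by rewrite big1_eq.
  by apply: ler_prod => n _; rewrite ler01 lerDl nrm_ge0.
(* Outside [F0] the product is within 1 of 1, hence at most 2. Inside, each factor is enlarged to
   [1 + nrm (z n)], which is at least 1, so that the product over a subset of [F0] is at most the
   one over [F0]. *)
exists (2 * \prod_(n <- F0) (1 + nrm (z n))) => [|F].
  by rewrite mulr_gt0 //; apply: lt_le_trans (ge1 F0).
rewrite (prod_fset_split _ (fsubsetIl F F0)) nrmM mulrC ler_pM ?nrm_ge0//.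
  have dis : [disjoint F `\` (F `&` F0) & F0]%fset.
    by apply/fdisjointP => n; rewrite !inE; case: (n \in F) => //=; rewrite !andbT.
  have -> : \prod_(n <- (F `\` (F `&` F0))%fset) z n =
     (\prod_(n <- (F `\` (F `&` F0))%fset) z n - 1) + 1 by ring.
  apply: le_trans (nrmD _ _) _; rewrite nrm1; have := HF0 _ dis; lra.
rewrite nrm_prod (prod_fset_split (fun n => 1 + nrm (z n)) (fsubsetIr F F0)).
rewrite -[leLHS]mulr1 ler_pM//; first by apply: prodr_ge0 => n _; exact: nrm_ge0.
by apply: ler_prod => n _; rewrite nrm_ge0 lerDr ler01.
Qed.

(** Convergence along the net of finite sets; it implies [uncond_prod] and is what the estimates
    produce. *)
Definition nprod z p : Prop := forall e : R, 0 < e ->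
  exists F0, forall F, (F0 `<=` F)%fset -> nrm (\prod_(n <- F) z n - p) <= e.

Lemma nprod_uncond_prod z p : nprod z p -> uncond_prod z p.
Proof.
move=> zp; apply: net_uncond_prod => e e0.
have e_real : e \is Num.real by rewrite gtr0_real.
move: e0; rewrite -(RRe_real e_real) ltcR => /zp [F0 HF0].
by exists F0 => F /HF0; rewrite nrmE lecR.
Qed.

Lemma nprod_qprod z p : nprod z p -> qprod z = p.
Proof.
move=> /nprod_uncond_prod zp; rewrite /qprod; case: xgetP => [a _ za|/(_ p)//].
exact: uncond_prod_unique za zp.
Qed.

(** The finite products form a Cauchy net: enlarging [F0] to [F] multiplies a bounded product by one
    close to 1. Initial segments provide the limit. *)
Lemma near1_nprod z : near1 z -> nprod z (qprod z).
Proof.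
move=> zs; suff [p zp] : exists p, nprod z p by rewrite (nprod_qprod zp).
have [D D0 HD] := near1_prod_bounded zs.
have cau (e : R) : 0 < e -> exists F0, forall F, (F0 `<=` F)%fset ->
    nrm (\prod_(n <- F) z n - \prod_(n <- F0) z n) <= e.
  move=> e0; have [F0 HF0] := near1_tail zs (divr_gt0 e0 D0).
  exists F0 => F FF0; rewrite (prod_fset_split _ FF0).
  set a := \prod_(n <- F0) _; set b := \prod_(n <- _) _.
  have -> : a * b - a = a * (b - 1) by ring.
  rewrite nrmM -(divfK (lt0r_neq0 D0) e) mulrC ler_pM ?nrm_ge0//.
    by apply: HF0; apply/fdisjointP => n; rewrite !inE => /andP[].
  exact: HD.
pose u N := \prod_(n < N) z n.
have segS N M : (N <= M)%N -> (fseg N `<=` fseg M)%fset.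
  by move=> NM; apply/fsubsetP => n; rewrite !in_fseg => /leq_trans; apply.
have subseg F : exists N, (F `<=` fseg N)%fset.
  by have [N HN] := fset_bound F; exists N; apply/fsubsetP => n /HN; rewrite in_fseg.
have [|l ul] := complex_cauchy_cvg (u := u).
  move=> e e0; have [F0 HF0] := cau _ (divr_gt0 e0 (ltr0Sn R 1)).
  have [N HN] := subseg F0; exists N => n Nn.
  have H1 := HF0 _ HN; have H2 := HF0 _ (fsubset_trans HN (segS _ _ Nn)).
  rewrite !prod_fseg -!/(u _) in H1 H2; apply: le_trans (nrmB_le (\prod_(n <- F0) z n) _ _) _.
  by rewrite [X in _ + X]nrmBC; lra.
exists l => e e0; have [F0 HF0] := cau _ (divr_gt0 e0 (ltr0Sn R 2)).
have [N HN] := ul _ (divr_gt0 e0 (ltr0Sn R 2)).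
have [M HM] := subseg F0; exists F0 => F FF0.
have H1 := HF0 _ FF0.
have H2 := HF0 _ (fsubset_trans HM (segS _ _ (leq_maxl M N))).
have H3 := HN _ (leq_maxr M N).
move: H2 H3; rewrite prod_fseg -/(u _) => H2 H3.
apply: le_trans (nrmB_le (\prod_(n <- F0) z n) _ _) _.
have := nrmB_le (u (maxn M N)) (\prod_(n <- F0) z n) l.
by rewrite [X in _ <= X + _ -> _]nrmBC; lra.
Qed.

Lemma nprod_le z p a (e : R) F0 : nprod z p ->
  (forall F, (F0 `<=` F)%fset -> nrm (\prod_(n <- F) z n - a) <= e) ->
  nrm (p - a) <= e.
Proof.
move=> zp za; apply/ler_addgt0Pr => d /zp [F1 HF1].
apply: le_trans (nrmB_le (\prod_(n <- (F0 `|` F1)%fset) z n) _ _) _.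
rewrite addrC lerD ?za ?fsubsetUl// nrmBC; apply: HF1; exact: fsubsetUr.
Qed.

Lemma near1_off F z : near1 z -> near1 (off F z).
Proof.
apply: (@summable_seqS _ _ _ 1) => n; rewrite mul1r /off; case: ifP => // _.
by rewrite subrr nrm0 normr0.
Qed.

Lemma prod_off (K : comNzRingType) (z : nat -> K) F G : (F `<=` G)%fset ->
  \prod_(n <- G) z n = \prod_(n <- F) z n * \prod_(n <- G) off F z n.
Proof.
move=> FG; rewrite (prod_fset_split z FG) [in RHS](prod_fset_split _ FG).
congr (_ * _); rewrite [X in _ = X * _]big_seq [X in _ = X * _]big1 ?mul1r.
  by rewrite !big_seq; apply: eq_bigr => n; rewrite !inE /off => /andP[/negbTE->].
by move=> n nF; rewrite /off nF.
Qed.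

Lemma qprod_off F z : near1 z -> qprod z = \prod_(n <- F) z n * qprod (off F z).
Proof.
move=> zs; apply: nprod_qprod => e e0.
set a := \prod_(n <- F) _.
(* The divisor is [1 + nrm a] since [a] may be zero. *)
have a1 : 0 < 1 + nrm a by apply: lt_le_trans ltr01 _; rewrite lerDl nrm_ge0.
have [F0 HF0] := near1_nprod (near1_off F zs) (divr_gt0 e0 a1).
exists (F0 `|` F)%fset => G; rewrite fsubUset => /andP[F0G FG].
rewrite (prod_off _ FG) -/a -mulrBr nrmM.
rewrite -[leRHS](divfK (lt0r_neq0 a1)) mulrC ler_pM ?nrm_ge0// ?lerDr//.
exact: HF0.
Qed.

Lemma qprod_tail z (e : R) : near1 z -> 0 < e ->
  exists F0, forall F, (F0 `<=` F)%fset -> nrm (qprod (off F z) - 1) <= e.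
Proof.
move=> zs e0; have [F0 HF0] := near1_tail zs e0; exists F0 => F F0F.
apply: (nprod_le (near1_nprod (near1_off F zs)) (F0 := F)) => G FG.
rewrite (prod_fset_split _ FG) big_seq big1 ?mul1r => [|n nF]; last first.
  by rewrite /off nF.
rewrite big_seq (eq_bigr z) => [|n]; last first.
  by rewrite !inE /off => /andP[/negbTE->].
rewrite -big_seq; apply: HF0; apply/fdisjointP => n; rewrite !inE => /andP[nF _].
by apply: contra nF; apply: (fsubsetP F0F).
Qed.

(** A tail within 1/2 of 1 is nonzero, and finitely many nonzero factors remain. *)
Lemma qprod_neq0 z : near1 z -> (forall n, z n != 0) -> qprod z != 0.
Proof.
move=> zs z0; have e0 : 0 < 2^-1 :> R by lra.
have [F0 /(_ _ (fsubset_refl _)) HF0] := qprod_tail zs e0.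
rewrite (qprod_off F0 zs) mulf_neq0 ?prodf_seq_neq0//.
  by apply/allP => n _; rewrite z0.
by apply/eqP => q0; move: HF0; rewrite q0 sub0r nrmN nrm1; lra.
Qed.

Lemma qprod_eq0 z k : z k = 0 -> qprod z = 0.
Proof.
move=> zk; apply: nprod_qprod => e e0; exists [fset k]%fset => F kF.
by rewrite (prod_fset_split _ kF) big_seq_fset1 zk mul0r subr0 nrm0 ltW.
Qed.

Lemma qprodM z w : near1 z -> near1 w ->
  qprod (fun n => z n * w n) = qprod z * qprod w.
Proof.
move=> zs ws; apply: nprod_qprod => e e0.
have [D D0 HD] := near1_prod_bounded zs.
set p := qprod z; set q := qprod w.
have q1 : 0 < 1 + nrm q by apply: lt_le_trans ltr01 _; rewrite lerDl nrm_ge0.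
have e20 : 0 < e / 2 by lra.
have [F1 HF1] := near1_nprod zs (divr_gt0 e20 q1).
have [F2 HF2] := near1_nprod ws (divr_gt0 e20 D0).
exists (F1 `|` F2)%fset => F; rewrite fsubUset => /andP[/HF1 H1 /HF2 H2].
rewrite big_split /=; set a := \prod_(n <- F) z n; set b := \prod_(n <- F) w n.
have -> : a * b - p * q = a * (b - q) + (a - p) * q by ring.
apply: le_trans (nrmD _ _) _; rewrite !nrmM.
have : nrm a * nrm (b - q) <= D * (e / 2 / D) by rewrite ler_pM ?nrm_ge0 ?HD.
have : nrm (a - p) * nrm q <= e / 2 / (1 + nrm q) * (1 + nrm q).
  by rewrite ler_pM ?nrm_ge0// lerDr.
rewrite divfK ?gt_eqF// [D * _]mulrC divfK ?gt_eqF//; lra.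
Qed.

End complex_products.

Lemma nth_prefix (T : eqType) (x0 : T) (s t : seq T) i : prefix s t -> (i < size s)%N ->
  nth x0 t i = nth x0 s i.
Proof. by move=> /prefixP[s' ->] si; rewrite nth_cat si. Qed.

Lemma prod_prefix (K : comNzRingType) (s t : seq nat) (f : nat -> K) : prefix s t ->
  \prod_(i < size s) f (nth 0%N t i) = \prod_(n <- s) f n.
Proof.
move=> st; rewrite [RHS](big_nth 0%N) big_mkord; apply: eq_bigr => i _.
by rewrite (nth_prefix _ st).
Qed.

(* Inserting the blocks [g s] greedily, and then the least missing index, yields
   an enumeration of the natural numbers. *)
Lemma block_enumeration (g : seq nat -> seq nat) :
  (forall s, uniq s -> uniq (s ++ g s)) -> (forall s, (0 < size (g s))%N) ->
  exists2 sigma : nat -> nat, bijective sigma &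
    forall N, exists s : seq nat, [/\ (N <= size s)%N, uniq s &
      forall (K : comNzRingType) (f : nat -> K),
        \prod_(i < size s) f (sigma i) = \prod_(n <- s) f n /\
        \prod_(i < size (s ++ g s)) f (sigma i) = \prod_(n <- s ++ g s) f n].
Proof.
move=> g_uniq g_gt0.
(* Round [k] appends the block of the current list and then [k] itself if still missing, which makes
   the enumeration surjective. *)
pose step (s : seq nat) k := let t := s ++ g s in if k \in t then t else rcons t k.
pose S := fix S k := if k is k'.+1 then step (S k') k' else [::].
have pre_step k : prefix (S k ++ g (S k)) (S k.+1).
  by rewrite /= /step; case: ifP => _; [exact: prefix_refl | exact: prefix_rcons].
have preS k : prefix (S k) (S k.+1).
  exact: prefix_trans (prefix_prefix _ _) (pre_step k).
have preSS j k : (j <= k)%N -> prefix (S j) (S k).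
  move=> /subnK <-; elim: (k - j)%N => [|m IH]; first exact: prefix_refl.
  by rewrite addSn; exact: prefix_trans IH (preS _).
have uS k : uniq (S k).
  elim: k => //= k IH; rewrite /step; case: ifPn => kt; first exact: g_uniq.
  by rewrite rcons_uniq kt g_uniq.
have szS k : (k <= size (S k))%N.
  elim: k => // k IH; apply: leq_trans (size_prefix (pre_step k)).
  by rewrite size_cat -addn1 leq_add.
have memS k : k \in S k.+1.
  by rewrite /= /step; case: ifPn => // _; rewrite mem_rcons mem_head.
(* [S n.+1] has at least n + 1 entries, so position n is never the default value. *)
pose sigma n := nth 0%N (S n.+1) n.
have sigmaE k i : (i < size (S k))%N -> nth 0%N (S k) i = sigma i.
  move=> ik; rewrite /sigma; case: (leqP k i.+1) => H.
    by rewrite (nth_prefix _ (preSS _ _ H)).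
  by rewrite (nth_prefix _ (preSS _ _ (ltnW H))).
have sigma_inj : injective sigma.
  move=> n m; set M := maxn n.+1 m.+1.
  have nM : (n < size (S M))%N by apply: leq_trans (szS _); rewrite leq_maxl.
  have mM : (m < size (S M))%N by apply: leq_trans (szS _); rewrite leq_maxr.
  by rewrite -(sigmaE M n nM) -(sigmaE M m mM) => /eqP; rewrite nth_uniq// => /eqP.
have sigmaK k : sigma (index k (S k.+1)) = k.
  by rewrite -(sigmaE k.+1) ?index_mem// nth_index.
exists sigma.
  by exists (fun k => index k (S k.+1)) => // n; apply: sigma_inj; rewrite sigmaK.
move=> N; exists (S N); split=> // K f.
have sz2 : (size (S N ++ g (S N)) <= size (S N.+1))%N := size_prefix (pre_step N).
split.
  rewrite -(prod_prefix _ (prefix_refl _)); apply: eq_bigr => i _.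
  by rewrite sigmaE.
rewrite -(prod_prefix _ (pre_step N)); apply: eq_bigr => i _.
by rewrite sigmaE // (leq_trans (ltn_ord i)).
Qed.

(** * Unconditional convergence to a nonzero value is absolute *)

Section unconditional.
Variable R : realType.
Local Notation C := R[i].
Local Notation re := complex.Re.
Implicit Types (z w : nat -> C) (a c : C) (F G : {fset nat}).

(** If the claim fails, every finite set is disjoint from some block with product Q at distance more
    than [e] from 1. A permutation that inserts such blocks again and again has partial products P
    and P Q arbitrarily late; both are close to a nonzero [a], which forces Q close to 1. *)
Lemma uncond_prod_tail z a (e : R) : uncond_prod z a -> a != 0 -> 0 < e ->
  exists F0, forall F, [disjoint F & F0]%fset -> nrm (\prod_(n <- F) z n - 1) <= e.
Proof.
move=> za a0 e0; apply: contrapT => /forallNP no.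
have /choice [G HG] : forall F0, exists F, [disjoint F & F0]%fset /\
    e < nrm (\prod_(n <- F) z n - 1).
  move=> F0; have /existsNP[F /not_implyP[dF /negP]] := no F0.
  by rewrite -ltNge => ?; exists F.
pose g (s : seq nat) : seq nat := G [fset n in s]%fset.
have g_uniq s : uniq s -> uniq (s ++ g s).
  move=> us; rewrite cat_uniq us fset_uniq andbT /=.
  apply/hasPn => n nG; have [/fdisjointP/(_ n nG) + _] := HG [fset n in s]%fset.
  by rewrite inE.
have g_gt0 s : (0 < size (g s))%N.
  rewrite lt0n size_eq0; apply/eqP => gs0.
  have [_] := HG [fset n in s]%fset; rewrite -/(g s) gs0 big_nil subrr nrm0.
  by rewrite ltNge (ltW e0).
have [sigma bij Hs] := block_enumeration g_uniq g_gt0.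
have na0 : 0 < nrm a by rewrite lt_def nrm_eq0 a0 nrm_ge0.
(* As d <= |a| / 4, |P| >= 3 |a| / 4; as d <= |a| e / 4, |P| |Q - 1| <= 2 d <= |a| e / 2. Together
   |Q - 1| <= e. *)
set d := nrm a * (Num.min e 1 / 4).
have m0 : 0 < Num.min e 1 by rewrite lt_min e0 ltr01.
have m1 : Num.min e 1 <= 1 by rewrite ge_min lexx orbT.
have me : Num.min e 1 <= e by rewrite ge_min lexx.
have d0 : 0 < d by rewrite mulr_gt0// divr_gt0.
have [N HN] := (cvgn_nrmP _ _).1 (za _ bij) _ d0.
have [s [Ns us /(_ _ z)[sE gE]]] := Hs N.
have H1 := HN _ Ns.
have H2 := HN _ (leq_trans Ns (leq_trans (leq_addr _ _) (eq_leq (esym (size_cat s (g s)))))).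
have [_] := HG [fset n in s]%fset.
move: H1 H2; rewrite sE gE big_cat /= -/(g s).
set P := \prod_(n <- s) z n; set Q := \prod_(n <- g s) z n => H1 H2.
apply/negP; rewrite -leNgt.
have PQ : nrm P * nrm (Q - 1) <= 2 * d.
  rewrite -nrmM; have -> : P * (Q - 1) = (P * Q - a) - (P - a) by ring.
  by apply: le_trans (nrmD _ _) _; rewrite nrmN; lra.
have Pa : nrm a - d <= nrm P.
  have := nrmD (a - P) P; rewrite subrK [nrm (a - P)]nrmBC; lra.
have dA : d <= nrm a / 4 by rewrite /d ler_pM2l//; lra.
have x0 : 0 <= nrm (Q - 1) := nrm_ge0 _.
rewrite -(ler_pM2l na0).
have := ler_wpM2r x0 Pa; have := ler_wpM2r x0 dA.
have := ler_wpM2l (ltW na0) me; have := mulr_ge0 (ltW na0) (ltW e0).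
have dE : d = nrm a * (Num.min e 1 / 4) by [].
by move: PQ; rewrite dE; clear -x0; lra.
Qed.

(* Write w n = z n - 1. The difference of the product minus 1 and the sum of the w n is
   at most (1/4) sum |w n|, whereas the w n, lying in one sector, do not cancel. *)
Lemma sector_sum z c (s : seq nat) : nrm c = 1 ->
  (forall n, n \in s -> nrm (z n - 1) <= 2 * re (c * (z n - 1))) ->
  (forall t, subseq t s -> nrm (\prod_(n <- t) z n - 1) <= 4^-1) ->
  \sum_(n <- s) nrm (z n - 1) <= 1.
Proof.
move=> c1 zc Hs; set S := \sum_(n <- s) _.
have H1 : nrm (\prod_(n <- s) z n - 1 - \sum_(n <- s) (z n - 1)) <= 4^-1 * S.
  rewrite {}/S; elim: s {zc} Hs => [|m s IH] Hs.
    by rewrite !big_nil subrr subr0 nrm0 mulr0.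
  rewrite !big_cons; set P := \prod_(n <- s) _ in IH *; set T := \sum_(n <- s) _ in IH *.
  set U := \sum_(n <- s) _ in IH *.
  have -> : z m * P - 1 - (z m - 1 + U) = (z m - 1) * (P - 1) + (P - 1 - U) by ring.
  apply: le_trans (nrmD _ _) _; rewrite [leRHS]mulrDr lerD//.
    rewrite nrmM mulrC ler_wpM2r ?nrm_ge0// /P; apply: Hs; exact: subseq_cons.
  by apply: IH => t ts; apply: Hs; apply: subseq_trans ts (subseq_cons _ _).
have H2 : S <= 2 * nrm (\sum_(n <- s) (z n - 1)).
  have -> : nrm (\sum_(n <- s) (z n - 1)) = nrm (c * \sum_(n <- s) (z n - 1)).
    by rewrite nrmM c1 mul1r.
  apply: (@le_trans _ _ (2 * re (c * \sum_(n <- s) (z n - 1)))).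
    rewrite mulr_sumr raddf_sum mulr_sumr /S big_seq [leRHS]big_seq.
    by apply: ler_sum => n ns; exact: zc.
  by rewrite ler_pM2l// (le_trans (ler_norm _) (Re_nrm _)).
have H3 : nrm (\sum_(n <- s) (z n - 1)) <= 4^-1 + 4^-1 * S.
  have -> : \sum_(n <- s) (z n - 1) = (\prod_(n <- s) z n - 1) -
    (\prod_(n <- s) z n - 1 - \sum_(n <- s) (z n - 1)) by ring.
  by apply: le_trans (nrmD _ _) _; rewrite nrmN lerD// Hs.
(* The bounds combine to S <= 2 (1/4 + S/4), that is S <= 1. *)
by lra.
Qed.

(** Since |w| <= |Re w| + |Im w|, every w satisfies |w| <= 2 Re (c w) for some c among 1, -1, i, -i.
    Off [F0] the terms thus fall into four sectors, each of total at most 1 by [sector_sum]; this is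
    the 4 in the bound. *)
Lemma uncond_prod_near1 z a : uncond_prod z a -> a != 0 -> near1 z.
Proof.
move=> za a0; have e0 : 0 < 4^-1 :> R by lra.
have [F0 HF0] := uncond_prod_tail za a0 e0.
pose sec c n := nrm (z n - 1) <= 2 * re (c * (z n - 1)).
pose cs : seq C := [:: 1; -1; 'i%C; - 'i%C].
have cs1 c : c \in cs -> nrm c = 1.
  by rewrite !inE => /or4P[] /eqP->; rewrite ?nrmN ?nrm1 ?nrmi.
exists (\sum_(n <- F0) nrm (z n - 1) + 4) => F.
have -> : \sum_(n <- F) `|nrm (1 - z n)| = \sum_(n <- F) nrm (z n - 1).
  by apply: eq_bigr => n _; rewrite ger0_norm ?nrm_ge0// nrmBC.
rewrite (sum_fset_split _ (fsubsetIl F F0)); apply: lerD.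
  rewrite (sum_fset_split (A := (F `&` F0)%fset) (B := F0)) ?fsubsetIr//.
  by rewrite lerDl; apply: sumr_ge0 => n _; exact: nrm_ge0.
set G := (_ `\` _)%fset.
have disG (t : seq nat) : subseq t G -> nrm (\prod_(n <- t) z n - 1) <= 4^-1.
  move=> tG; have ut : uniq t := subseq_uniq tG (fset_uniq _).
  have -> : \prod_(n <- t) z n = \prod_(n <- [fset n in t]%fset) z n.
    by apply: perm_big; apply: uniq_perm; rewrite ?fset_uniq// => n; rewrite inE.
  apply: HF0; apply/fdisjointP => n; rewrite inE => /(mem_subseq tG).
  by rewrite !inE; case: (n \in F) => //=; rewrite !andbT.
have sub c : c \in cs -> \sum_(n <- G | sec c n) nrm (z n - 1) <= 1.
  move=> /cs1 c1; rewrite -big_filter; apply: sector_sum c1 _ _.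
    by move=> n; rewrite mem_filter => /andP[].
  by move=> t tG; apply: disG; apply: subseq_trans tG (filter_subseq _ _).
apply: (@le_trans _ _ (\sum_(c <- cs) \sum_(n <- G | sec c n) nrm (z n - 1))).
  rewrite (eq_bigr (fun c => \sum_(n <- G) if sec c n then nrm (z n - 1) else 0)).
    2: by move=> c _; rewrite big_mkcond.
  rewrite exchange_big /=; apply: ler_sum => n _; rewrite -big_mkcond /=.
  have : has (sec^~ n) cs.
    rewrite /cs /= /sec; set v := z n - 1.
    have := nrm_ReIm v.
    have -> : re (1 * v) = re v by rewrite mul1r.
    have -> : re (-1 * v) = - re v by rewrite mulN1r raddfN.
    have -> : re ('i%C * v) = - complex.Im v by rewrite mulrC ReiNIm.
    have -> : re (- 'i%C * v) = complex.Im v by rewrite mulNr raddfN/= mulrC ReiNIm opprK.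
    move=> Hv; apply/or4P.
    case: (lerP 0 (re v)) Hv => Hr; [rewrite (ger0_norm Hr)|rewrite (ltr0_norm Hr)];
    (case: (lerP 0 (complex.Im v)) => Hi; [rewrite (ger0_norm Hi)|rewrite (ltr0_norm Hi)]) => Hv.
    - case: (lerP (complex.Im v) (re v)) => H; [constructor 1|constructor 4]; lra.
    - case: (lerP (- complex.Im v) (re v)) => H; [constructor 1|constructor 3]; lra.
    - case: (lerP (complex.Im v) (- re v)) => H; [constructor 2|constructor 4]; lra.
    - case: (lerP (- complex.Im v) (- re v)) => H; [constructor 2|constructor 3]; lra.
  move=> /hasP[c ccs cn]; rewrite (big_rem c)//= cn lerDl.
  by apply: sumr_ge0 => c' _; exact: nrm_ge0.
have -> : 4 = \sum_(c <- cs) (1 : R) by rewrite !big_cons big_nil; lra.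
by rewrite big_seq [leRHS]big_seq; apply: ler_sum => c; exact: sub.
Qed.

End unconditional.

(** * Products of real factors *)

Section real_products.
Variable R : realType.
Implicit Types (r : nat -> R) (F : {fset nat}).

Definition rprod r : R := complex.Re (qprod (fun n => (r n)%:C%C : R[i])).

Lemma Re_realM (a : R) (z : R[i]) : complex.Re (a%:C%C * z) = a * complex.Re z.
Proof. by case: z => x z /=; rewrite mul0r subr0. Qed.

Lemma near1_real r : summable_seq (fun n => 1 - r n) ->
  near1 (fun n => (r n)%:C%C : R[i]).
Proof.
move=> rs; rewrite /near1 (_ : (fun n => _) = fun n => `|1 - r n|).
  exact: summable_seq_abs.
by apply/funext => n; rewrite -nrm_real rmorphB rmorph1.
Qed.

Lemma prod_realC r (s : seq nat) :
  \prod_(n <- s) ((r n)%:C%C : R[i]) = (\prod_(n <- s) r n)%:C%C.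
Proof. by rewrite rmorph_prod. Qed.

Lemma rprod_net r (e : R) : summable_seq (fun n => 1 - r n) -> 0 < e ->
  exists F0, forall F, (F0 `<=` F)%fset -> `|\prod_(n <- F) r n - rprod r| <= e.
Proof.
move=> /near1_real/near1_nprod rp /rp [F0 HF0]; exists F0 => F /HF0.
by apply: le_trans; rewrite prod_realC; apply: le_trans (Re_nrm _); rewrite raddfB.
Qed.

Lemma qprod_real r : summable_seq (fun n => 1 - r n) ->
  qprod (fun n => (r n)%:C%C : R[i]) = (rprod r)%:C%C.
Proof.
move=> rs; apply: nprod_qprod => e e0.
have [F0 HF0] := rprod_net rs e0; exists F0 => F /HF0.
by rewrite prod_realC -rmorphB nrm_real.
Qed.

Lemma rprod_uncond_prod r : summable_seq (fun n => 1 - r n) -> uncond_prod r (rprod r).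
Proof. by move=> rs; apply: net_uncond_prod => e; exact: rprod_net. Qed.

Lemma rprod_ge0 r : summable_seq (fun n => 1 - r n) -> (forall n, 0 <= r n) ->
  0 <= rprod r.
Proof.
move=> rs r0; apply/ler_addgt0Pr => e /(rprod_net rs)[F0 /(_ _ (fsubset_refl _))].
have : 0 <= \prod_(n <- F0) r n by apply: prodr_ge0 => n _.
by rewrite ler_norml => + /andP[]; lra.
Qed.

Lemma off_real F r : (fun n => (off F r n)%:C%C : R[i]) = off F (fun n => (r n)%:C%C).
Proof. by apply/funext => n; rewrite /off; case: ifP => // _; rewrite rmorph1. Qed.

Lemma summable_off F r : summable_seq (fun n => 1 - r n) ->
  summable_seq (fun n => 1 - off F r n).
Proof.
apply: (@summable_seqS _ _ _ 1) => n; rewrite mul1r /off; case: ifP => // _.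
by rewrite subrr normr0.
Qed.

Lemma rprod_off F r : summable_seq (fun n => 1 - r n) ->
  rprod r = \prod_(n <- F) r n * rprod (off F r).
Proof.
move=> rs; rewrite {1}/rprod (qprod_off F (near1_real rs)) prod_realC -off_real.
exact: Re_realM.
Qed.

Lemma rprod_tail r (e : R) : summable_seq (fun n => 1 - r n) -> 0 < e ->
  exists F0, forall F, (F0 `<=` F)%fset -> `|rprod (off F r) - 1| <= e.
Proof.
move=> rs /(qprod_tail (near1_real rs))[F0 HF0]; exists F0 => F /HF0.
rewrite -off_real; apply: le_trans; apply: le_trans (Re_nrm _).
by rewrite raddfB.
Qed.

Lemma rprod_gt0 r : summable_seq (fun n => 1 - r n) -> (forall n, 0 < r n) ->
  0 < rprod r.
Proof.
move=> rs r0; rewrite lt_def rprod_ge0// => [|n]; last exact: ltW.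
rewrite andbT; have := qprod_neq0 (near1_real rs); rewrite qprod_real//.
move=> /(_ _)/wrap[n|]; first by rewrite eq_complex /= eqxx andbT gt_eqF.
by apply: contra => /eqP->; rewrite rmorph0.
Qed.

Lemma rprod_le_bound r (D : R) : summable_seq (fun n => 1 - r n) ->
  (forall F, \prod_(n <- F) r n <= D) -> rprod r <= D.
Proof.
move=> rs rD; apply/ler_addgt0Pr => e /(rprod_net rs)[F0 /(_ _ (fsubset_refl _))].
by rewrite ler_norml => /andP[]; have := rD F0; lra.
Qed.

Lemma summable_sqr r : summable_seq (fun n => 1 - r n) ->
  summable_seq (fun n => 1 - r n ^+ 2).
Proof.
move=> rs; have [B B0 HB] := summable_seq_bounded rs.
apply: (@summable_seqS _ _ _ (2 + B)) rs => n.
have -> : 1 - r n ^+ 2 = (1 + r n) * (1 - r n) by ring.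
rewrite normrM ler_wpM2r//; have := HB n.
have -> : 1 + r n = 2 - (1 - r n) by ring.
move=> Hn; apply: le_trans (ler_normB _ _) _; rewrite lerD// ger0_norm//.
Qed.

(** Inner products control squared norms, whereas C_0-sequences are defined by norms; here the
    factor 1 + r of 1 - r^2 is at least 1. *)
Lemma summable_sqrt r : (forall n, 0 <= r n) -> summable_seq (fun n => 1 - r n ^+ 2) ->
  summable_seq (fun n => 1 - r n).
Proof.
move=> r0; apply: (@summable_seqS _ _ _ 1) => n.
have -> : 1 - r n ^+ 2 = (1 + r n) * (1 - r n) by ring.
rewrite mul1r normrM ler_peMl// ger0_norm; have := r0 n; lra.
Qed.

Lemma summable_modif (F : {fset nat}) (u v : nat -> R) :
  (forall n, n \notin F -> u n = v n) -> summable_seq v -> summable_seq u.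
Proof.
move=> uv [D vD]; exists (\sum_(n <- F) `|u n| + D) => G.
rewrite (sum_fset_split _ (fsubsetIl G F)); apply: lerD.
  rewrite (sum_fset_split (A := (G `&` F)%fset) (B := F)) ?fsubsetIr//.
  by rewrite lerDl; apply: sumr_ge0.
rewrite big_seq (eq_bigr (fun n => `|v n|)) -?big_seq//.
move=> n; rewrite !inE => /andP[nGF nG]; rewrite uv//.
by move: nGF; rewrite nG.
Qed.

End real_products.

(** * Hilbert spaces and C_0-sequences *)

Section hilbert.
Variables (R : realType).
Local Notation C := R[i].
Local Notation re := complex.Re.
Local Notation im := complex.Im.
Implicit Types (H : hilbertType R).

Lemma innerDl H (x x' z : H) : inner (x + x') z = inner x z + inner x' z.
Proof. exact: linearDl. Qed.

Lemma innerZl H c (x z : H) : inner (c *: x) z = c * inner x z.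
Proof. exact: linearZl_LR. Qed.

Lemma innerC H (x z : H) : inner x z = Num.conj (inner z x).
Proof. by rewrite hermC expr0 mul1r. Qed.

Lemma innerDr H (x z z' : H) : inner x (z + z') = inner x z + inner x z'.
Proof. exact: linearDr. Qed.

Lemma innerZr H c (x z : H) : inner x (c *: z) = Num.conj c * inner x z.
Proof. by rewrite innerC innerZl rmorphM /= [in RHS]innerC. Qed.

Lemma innerNl H (x z : H) : inner (- x) z = - inner x z.
Proof. exact: linearNl. Qed.

Lemma innerNr H (x z : H) : inner x (- z) = - inner x z.
Proof. exact: linearNr. Qed.

Lemma inner0l H (z : H) : inner 0 z = 0.
Proof. exact: linear0l. Qed.

Lemma inner_suml H (I : Type) (s : seq I) (x : I -> H) z :
  inner (\sum_(i <- s) x i) z = \sum_(i <- s) inner (x i) z.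
Proof. exact: linear_sumlz. Qed.

Lemma inner_sumr H (I : Type) (s : seq I) (x : I -> H) z :
  inner z (\sum_(i <- s) x i) = \sum_(i <- s) inner z (x i).
Proof. exact: linear_sumr. Qed.

Lemma innerxx H (x : H) : inner x x = (nrm x ^+ 2)%:C%C.
Proof. by rewrite -sqr_norm_inner nrmE -rmorphXn. Qed.

Lemma re_conj (z : C) : re (Num.conj z) = re z.
Proof. by case: z. Qed.

Lemma re_innerC H (x z : H) : re (inner x z) = re (inner z x).
Proof. by rewrite innerC re_conj. Qed.

Lemma nrmD_sqr H (x z : H) : nrm (x + z) ^+ 2 = nrm x ^+ 2 + nrm z ^+ 2 + 2 * re (inner x z).
Proof.
have -> : nrm (x + z) ^+ 2 = re (inner (x + z) (x + z)) by rewrite innerxx.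
by rewrite innerDl !innerDr !innerxx !raddfD /= [re (inner z x)]re_innerC; ring.
Qed.

Lemma nrmB_sqr H (x z : H) : nrm (x - z) ^+ 2 = nrm x ^+ 2 + nrm z ^+ 2 - 2 * re (inner x z).
Proof. by rewrite nrmD_sqr nrmN innerNr raddfN /= mulrN. Qed.

Lemma re_iM (z : C) : re (Num.conj 'i%C * z) = im z.
Proof.
have -> : Num.conj 'i%C = - 'i%C :> C by apply/eqP; rewrite eq_complex /= oppr0 !eqxx.
by rewrite mulNr raddfN/= mulrC ReiNIm opprK.
Qed.

(* Cauchy-Schwarz, in a weak form free of square roots, for the positive
   semidefinite form M^2 <u, v> - <A u, A v>. *)
Lemma defect_form_le H H' (A : H -> H') (M : R) (u v : H) :
  (forall c x x', A (c *: x + x') = c *: A x + A x') ->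
  (forall x, nrm (A x) <= M * nrm x) ->
  nrm ((M ^+ 2)%:C%C * inner u v - inner (A u) (A v)) <=
  M ^+ 2 * nrm u ^+ 2 + (M ^+ 2 * nrm v ^+ 2 - nrm (A v) ^+ 2).
Proof.
move=> linA MA.
have pos x : nrm (A x) ^+ 2 <= M ^+ 2 * nrm x ^+ 2.
  rewrite -exprMn; have := MA x; have := nrm_ge0 (A x).
  by move=> *; rewrite lerXn2r// ?nnegrE//; lra.
set z := _ - _.
have H1 c : nrm c = 1 -> `|2 * re (Num.conj c * z)| <= M ^+ 2 * nrm u ^+ 2 +
    (M ^+ 2 * nrm v ^+ 2 - nrm (A v) ^+ 2).
  move=> c1.
  (* Positivity of the form at [d *: v + u], with the term - |A u|^2 dropped from the upper
     bound. *)
  have expand (d : C) : nrm d = 1 -> - (2 * re (Num.conj d * z)) <= M ^+ 2 * nrm u ^+ 2 +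
    (M ^+ 2 * nrm v ^+ 2 - nrm (A v) ^+ 2).
    move=> d1; have := pos (d *: v + u); rewrite linA !nrmD_sqr !nrmZ d1 !mul1r.
    rewrite !innerZl ![inner _ u]innerC ![inner _ (A u)]innerC.
    rewrite -[d]conjCK -!rmorphM !re_conj /z mulrBr raddfB /=.
    have -> : Num.conj (Num.conj (Num.conj d)) = Num.conj d by rewrite conjCK.
    have -> : re (Num.conj d * ((M ^+ 2)%:C%C * inner u v)) =
       M ^+ 2 * re (Num.conj d * inner u v).
      by rewrite mulrCA; case: (Num.conj d * inner u v) => a b /=; ring.
    have := sqr_ge0 (nrm (A u)); lra.
  rewrite ler_norml; apply/andP; split; first by have := expand _ c1; lra.
  have := expand (- c); rewrite nrmN rmorphN mulNr raddfN => /(_ c1) /=; lra.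
(* The choices c = 1 and c = i bound the real and the imaginary part of z by half of the right-hand
   side each. *)
have := H1 1 (nrm1 _); have := H1 _ (nrmi R).
rewrite re_iM rmorph1 mul1r !normrM ger0_norm//.
by have := nrm_ReIm z; lra.
Qed.

Lemma inner_le H (u v : H) : nrm (inner u v) <= nrm u ^+ 2 + nrm v ^+ 2.
Proof.
have := @defect_form_le H H (fun=> 0) 1 u v; rewrite expr1n rmorph1 !mul1r.
rewrite inner0l subr0 nrm0 expr0n /= subr0; apply => [c _ _|x].
  by rewrite scaler0 addr0.
by rewrite mul1r nrm_ge0.
Qed.

End hilbert.

Lemma summable_seqM (R : realType) (a b : nat -> R) : summable_seq (fun n => 1 - a n) ->
  summable_seq (fun n => 1 - b n) -> summable_seq (fun n => 1 - a n * b n).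
Proof.
move=> sa sb; have [B B0 HB] := summable_seq_bounded sa.
apply: (@summable_seq_le _ _ (fun n => `|1 - a n| + (1 + B) * `|1 - b n|)) => [n|].
  have -> : 1 - a n * b n = (1 - a n) + a n * (1 - b n) by ring.
  apply: le_trans (ler_normD _ _) _; rewrite lerD2l normrM ler_wpM2r//.
  have -> : a n = 1 - (1 - a n) by ring.
  by apply: le_trans (ler_normB _ _) _; rewrite normr1 lerD2l.
by apply: summable_seqD; [|apply: summable_seqZ]; apply: summable_seq_abs.
Qed.

(** * C_0-sequences, their equivalence and their images under operators *)

Section C0_sequences.
Variables (R : realType) (H : nat -> hilbertType R).
Local Notation re := complex.Re.
Implicit Types f g h y : forall n, H n.

Lemma C0_seqP h : C0_seq h <-> summable_seq (fun n => 1 - nrm (h n)).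
Proof.
have E : summable_seq (fun n => nrm (1 - `|h n|)) <-> summable_seq (fun n => 1 - nrm (h n)).
  have {1}-> : (fun n => nrm (1 - `|h n|)) = (fun n => `|1 - nrm (h n)|).
    by apply/funext => n; rewrite nrmE -nrm_real rmorphB rmorph1.
  split; last exact: summable_seq_abs.
  by apply: (@summable_seqS _ _ _ 1) => n; rewrite mul1r normr_id.
rewrite /C0_seq abs_summableP E; split=> [[]//|hs]; split=> //.
exists (qprod (fun n => (nrm (h n))%:C%C : R[i])).
have -> : (fun n => `|h n|) = (fun n => (nrm (h n))%:C%C : R[i]).
  by apply/funext => n; rewrite nrmE.
by apply: nprod_uncond_prod; apply: near1_nprod; apply: near1_real.
Qed.

Lemma C0_of_near1 h : near1 (fun n => `|h n|) -> C0_seq h.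
Proof.
move=> hs; apply/C0_seqP; apply: (@summable_seqS _ _ _ 1) hs => n.
by rewrite mul1r nrmE -(rmorph1 (real_complex R)) -rmorphB nrm_real normr_id.
Qed.

Lemma C0_C_seq h : C0_seq h -> C_seq h.
Proof. by case. Qed.

Lemma C0_equivP h f : C0_equiv h f <-> near1 (fun n => inner (h n) (f n)).
Proof. exact: abs_summableP. Qed.

Lemma C0_sqr h : C0_seq h -> summable_seq (fun n => 1 - nrm (h n) ^+ 2).
Proof. by move=> /C0_seqP; exact: summable_sqr. Qed.

Lemma C0_of_sqr h : summable_seq (fun n => 1 - nrm (h n) ^+ 2) -> C0_seq h.
Proof. by move=> hs; apply/C0_seqP; apply: summable_sqrt hs => n; exact: nrm_ge0. Qed.

Lemma C0_equiv_refl h : C0_seq h -> C0_equiv h h.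
Proof.
move=> /C0_sqr hs; apply/C0_equivP.
have -> : (fun n => inner (h n) (h n)) = (fun n => (nrm (h n) ^+ 2)%:C%C).
  by apply/funext => n; rewrite innerxx.
exact: near1_real.
Qed.

Lemma C0_equiv_sym h f : C0_equiv h f -> C0_equiv f h.
Proof.
move=> /C0_equivP hf; apply/C0_equivP; apply: summable_seq_le hf => n.
by rewrite ger0_norm ?nrm_ge0// innerC -[leRHS]nrm_conj rmorphB rmorph1.
Qed.

(** |h - f|^2 = 2 Re (1 - <h,f>) - (1 - |h|^2) - (1 - |f|^2), a sum of three summable terms. *)
Lemma C0_equiv_sqdist h f : C0_seq h -> C0_seq f -> C0_equiv h f ->
  summable_seq (fun n => nrm (h n - f n) ^+ 2).
Proof.
move=> /C0_sqr hs /C0_sqr fs /C0_equivP hf.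
apply: (@summable_seq_le _ _ (fun n => (`|1 - nrm (h n) ^+ 2| + `|1 - nrm (f n) ^+ 2|) +
   2 * nrm (1 - inner (h n) (f n)))) => [n|].
  rewrite ger0_norm ?sqr_ge0// nrmB_sqr.
  have := Re_nrm (1 - inner (h n) (f n)); rewrite raddfB /= => Hr.
  have := ler_norm (- (1 - nrm (h n) ^+ 2)); have := ler_norm (- (1 - nrm (f n) ^+ 2)).
  rewrite !normrN; have := le_trans (ler_norm _) Hr; lra.
apply: summable_seqD; last exact: summable_seqZ.
by apply: summable_seqD; apply: summable_seq_abs.
Qed.

(* 1 - <h,g> = (1 - <h,f>) + (1 - <f,g>) - (1 - <f,f>) + <h-f, f-g>, and h-f, f-g are
   square summable. *)
Lemma C0_equiv_trans h f g : C0_seq h -> C0_seq f -> C0_seq g ->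
  C0_equiv h f -> C0_equiv f g -> C0_equiv h g.
Proof.
move=> h0 f0 g0 hf fg.
have s1 := C0_equiv_sqdist h0 f0 hf.
have s2 := C0_equiv_sqdist f0 g0 fg.
have /C0_equivP s3 := C0_equiv_refl f0.
move: hf fg => /C0_equivP hf /C0_equivP fg; apply/C0_equivP.
apply: (@summable_seq_le _ _ (fun n => (nrm (1 - inner (h n) (f n)) +
  nrm (1 - inner (f n) (g n))) + (nrm (1 - inner (f n) (f n)) +
  (nrm (h n - f n) ^+ 2 + nrm (f n - g n) ^+ 2)))) => [n|]; last first.
  by apply: summable_seqD; [|apply: summable_seqD => //]; apply: summable_seqD.
rewrite ger0_norm ?nrm_ge0//.
have -> : 1 - inner (h n) (g n) = ((1 - inner (h n) (f n)) + (1 - inner (f n) (g n)))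
   + (- (1 - inner (f n) (f n)) + inner (h n - f n) (f n - g n)).
  by rewrite !(innerDl, innerDr, innerNl, innerNr); ring.
apply: le_trans (nrmD _ _) _; apply: lerD; first exact: nrmD.
by apply: le_trans (nrmD _ _) _; rewrite nrmN lerD2l inner_le.
Qed.

Section image.
Variables (A : forall n, H n -> H n) (M : nat -> R).
Arguments A : clear implicits.
Hypothesis linA : forall n c x x', A n (c *: x + x') = c *: A n x + A n x'.
Hypothesis MA : forall n x, nrm (A n x) <= M n * nrm x.
Hypothesis M1 : forall n, 1 <= M n.
Hypothesis M_summable : summable_seq (fun n => 1 - M n).

(** |A y|^2 is at most M^2 |y|^2 and, because |A y - y|^2 >= 0, at least 2 Re <A y, y> - |y|^2; both
    bounds differ from 1 by summable amounts. *)
Lemma C0_image y : C0_seq y -> C0_equiv (fun n => A n (y n)) y ->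
  C0_seq (fun n => A n (y n)).
Proof.
move=> y0 /C0_equivP Ay; apply: C0_of_sqr.
have ys := C0_sqr y0.
have Mys := summable_seqM (summable_sqr M_summable) ys.
apply: (@summable_seq_le _ _ (fun n => `|1 - M n ^+ 2 * nrm (y n) ^+ 2| +
  (2 * nrm (1 - inner (A n (y n)) (y n)) + `|1 - nrm (y n) ^+ 2|))) => [n|]; last first.
  apply: summable_seqD; first exact: summable_seq_abs.
  by apply: summable_seqD; [apply: summable_seqZ|apply: summable_seq_abs].
have H1 : nrm (A n (y n)) ^+ 2 <= M n ^+ 2 * nrm (y n) ^+ 2.
  rewrite -exprMn lerXn2r// ?nnegrE ?nrm_ge0// mulr_ge0 ?nrm_ge0//.
  exact: le_trans ler01 (M1 n).
have H2 := sqr_ge0 (nrm (A n (y n) - y n)); rewrite nrmB_sqr in H2.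
have H3 := le_trans (ler_norm _) (Re_nrm (1 - inner (A n (y n)) (y n))).
rewrite raddfB /= in H3.
have H4 := ler_norm (- (1 - M n ^+ 2 * nrm (y n) ^+ 2)); rewrite normrN in H4.
have H5 := ler_norm (- (1 - nrm (y n) ^+ 2)); rewrite normrN in H5.
have H6 := normr_ge0 (1 - M n ^+ 2 * nrm (y n) ^+ 2).
have H7 := normr_ge0 (1 - nrm (y n) ^+ 2).
have H8 := nrm_ge0 (1 - inner (A n (y n)) (y n)).
by rewrite ler_norml; apply/andP; split; lra.
Qed.

(** With d = h - g, everything reduces to |A d|^2, summable as d is square summable, and to the
    cross term <A d, A g>. The latter is M^2 <d, g> minus the defect form at (d, g), and
    [defect_form_le] bounds that form by M^2 |d|^2 plus the defect M^2 |g|^2 - |A g|^2, which is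
    summable because M^2 |g|^2 and |A g|^2 are both summably close to 1. *)
Lemma C0_image_equiv g h : C0_seq g -> C0_seq (fun n => A n (g n)) -> C0_seq h ->
  C0_equiv h g ->
  C0_seq (fun n => A n (h n)) /\ C0_equiv (fun n => A n (h n)) (fun n => A n (g n)).
Proof.
move=> g0 Ag0 h0 hg.
have ds := C0_equiv_sqdist h0 g0 hg.
have gs := C0_sqr g0; have Ags := C0_sqr Ag0.
have M2s := summable_sqr M_summable.
have [B B0 HB] := summable_seq_bounded M2s.
have MB n : M n ^+ 2 <= 1 + B.
  by have := HB n; rewrite ler_norml => /andP[]; lra.
have M2_ge0 n : 0 <= M n ^+ 2 by rewrite sqr_ge0.
have M2gs := summable_seqM M2s gs.
have hgs := (C0_equivP _ _).1 hg.
pose d n := h n - g n.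
have linD n : A n (h n) = A n (g n) + A n (d n).
  have := linA 1 (d n) (g n); rewrite !scale1r /d subrK => ->; exact: addrC.
(* The first group bounds the defect form, the second M^2 <d, g>, where <d, g> = (1 - <g,g>) - (1 -
   <h,g>); [1 + B] bounds M^2. *)
pose E n : R := ((1 + B) * nrm (d n) ^+ 2 + (`|1 - M n ^+ 2 * nrm (g n) ^+ 2| +
  `|1 - nrm (A n (g n)) ^+ 2|)) +
  (1 + B) * (`|1 - nrm (g n) ^+ 2| + nrm (1 - inner (h n) (g n))).
have Es : summable_seq E.
  apply: summable_seqD; [apply: summable_seqD|apply: summable_seqZ].
  - exact: summable_seqZ.
  - by apply: summable_seqD; apply: summable_seq_abs.
  - by apply: summable_seqD => //; apply: summable_seq_abs.
have cross n : nrm (inner (A n (d n)) (A n (g n))) <= E n.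
  have -> : inner (A n (d n)) (A n (g n)) = (M n ^+ 2)%:C%C * inner (d n) (g n) -
    ((M n ^+ 2)%:C%C * inner (d n) (g n) - inner (A n (d n)) (A n (g n))) by ring.
  apply: le_trans (nrmD _ _) _; rewrite nrmN addrC lerD//.
    apply: le_trans (defect_form_le _ _ (@linA n) (@MA n)) _.
    rewrite lerD ?ler_wpM2r ?sqr_ge0//.
    have := ler_norm (- (1 - M n ^+ 2 * nrm (g n) ^+ 2)).
    have := ler_norm (1 - nrm (A n (g n)) ^+ 2); rewrite normrN; lra.
  rewrite nrmM nrm_real ger0_norm//; apply: ler_pM => //; first exact: nrm_ge0.
  have -> : inner (d n) (g n) = (1 - inner (g n) (g n)) - (1 - inner (h n) (g n)).
    by rewrite /d innerDl innerNl; ring.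
  apply: le_trans (nrmD _ _) _; rewrite nrmN lerD2r innerxx.
  by rewrite -(rmorph1 (real_complex R)) -rmorphB nrm_real.
have Ad n : nrm (A n (d n)) ^+ 2 <= (1 + B) * nrm (d n) ^+ 2.
  apply: (@le_trans _ _ (M n ^+ 2 * nrm (d n) ^+ 2)); last by rewrite ler_wpM2r ?sqr_ge0.
  rewrite -exprMn lerXn2r// ?nnegrE ?nrm_ge0// mulr_ge0 ?nrm_ge0//.
  exact: le_trans ler01 (M1 n).
split.
  apply: C0_of_sqr; apply: (@summable_seq_le _ _ (fun n => `|1 - nrm (A n (g n)) ^+ 2| +
    ((1 + B) * nrm (d n) ^+ 2 + 2 * E n))) => [n|]; last first.
    apply: summable_seqD; first exact: summable_seq_abs.
    by apply: summable_seqD; apply: summable_seqZ.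
  rewrite linD nrmD_sqr re_innerC.
  have := le_trans (Re_nrm _) (cross n); rewrite ler_norml => /andP[].
  have := Ad n; have := sqr_ge0 (nrm (A n (d n))).
  have := ler_norm (1 - nrm (A n (g n)) ^+ 2).
  have := ler_norm (- (1 - nrm (A n (g n)) ^+ 2)); rewrite normrN.
  by move=> *; rewrite ler_norml; apply/andP; split; lra.
apply/C0_equivP; apply: (@summable_seq_le _ _ (fun n => `|1 - nrm (A n (g n)) ^+ 2| + E n)).
  move=> n; rewrite ger0_norm ?nrm_ge0// linD innerDl innerxx opprD addrA.
  apply: le_trans (nrmD _ _) _; rewrite nrmN; apply: lerD => //.
  by rewrite -(rmorph1 (real_complex R)) -rmorphB nrm_real.
by apply: summable_seqD => //; exact: summable_seq_abs.
Qed.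

End image.
End C0_sequences.

(* Otherwise unification unfolds these down to limits, and does not terminate in practice. *)
Opaque C0_seq C0_equiv C_seq.

(** * Operators on closed spans *)

Section closed_span.
Variable R : realType.
Local Notation C := R[i].
Local Notation re := complex.Re.

Lemma closure_nrmP (V : normedModType C) (U : set V) x :
  closure U x <-> forall e : R, 0 < e -> exists2 a, U a & nrm (x - a) <= e.
Proof.
split=> [Ux e e0|Ux B /nbhs_ballP[e /= e0 eB]].
  have e0' : 0 < e%:C%C by rewrite ltcR.
  have [a [Ua]] := Ux _ (nbhsx_ballx x _ e0').
  rewrite -ball_normE /= nrmE ltcR => xa; exists a => //; exact: ltW.
have e_real : e \is Num.real by rewrite gtr0_real.
move: (e0); rewrite -(RRe_real e_real) ltcR => re0.
have [a Ua xa] := Ux _ (divr_gt0 re0 (ltr0Sn R 1)); exists a; split=> //; apply: eB.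
rewrite -ball_normE /= nrmE -(RRe_real e_real) ltcR.
by apply: le_lt_trans xa _; rewrite ltr_pdivrMr// ltr_pMr// ltr1n.
Qed.

Section combinations.
Variables (V : lmodType C) (J : Type) (P : J -> Prop).
Implicit Types u v : J -> V.

(** [u] is quantified last, so that the same coefficients and indices serve two families at once, as
    the graph in [bounded_extension] requires. *)
Lemma combination_concat m m' (c : C) (d : 'I_m -> C) (d' : 'I_m' -> C)
    (s : 'I_m -> J) (s' : 'I_m' -> J) : (forall i, P (s i)) -> (forall i, P (s' i)) ->
  exists (e : 'I_(m + m') -> C) (t : 'I_(m + m') -> J), (forall i, P (t i)) /\
    forall u, \sum_(i < m + m') e i *: u (t i) =
      c *: \sum_(i < m) d i *: u (s i) + \sum_(i < m') d' i *: u (s' i).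
Proof.
move=> sP s'P.
exists (fun i => match fintype.split i with inl j => c * d j | inr j => d' j end).
exists (fun i => match fintype.split i with inl j => s j | inr j => s' j end); split.
  by move=> i; case: (fintype.split i).
move=> u; rewrite big_split_ord /= scaler_sumr; congr (_ + _); apply: eq_bigr => i _.
  by have := unsplitK (inl i : 'I_m + 'I_m'); rewrite /= => ->; rewrite scalerA.
by have := unsplitK (inr i : 'I_m + 'I_m'); rewrite /= => ->.
Qed.

End combinations.

Lemma lspan_linear (V : lmodType C) (S : set V) (c : C) x x' :
  lspan S x -> lspan S x' -> lspan S (c *: x + x').
Proof.
move=> [m [d [s [sS ->]]]] [m' [d' [s' [s'S ->]]]].
have [e [t [tS E]]] := combination_concat V c d d' sS s'S.
by exists (m + m')%N, e, t; split=> //; rewrite (E id).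
Qed.

Lemma lspan_sub (V : lmodType C) (S : set V) : S `<=` lspan S.
Proof.
move=> x Sx; exists 1%N, (fun=> 1), (fun=> x); split=> //.
by rewrite big_ord1 scale1r.
Qed.

Lemma lspan0 (V : lmodType C) (S : set V) : lspan S 0.
Proof.
exists 0%N, (fun=> 1), (fun=> 0); split; first by case.
by rewrite big_ord0.
Qed.

Lemma closure_lspan_linear (V : normedModType C) (S : set V) (c : C) x x' :
  closure (lspan S) x -> closure (lspan S) x' -> closure (lspan S) (c *: x + x').
Proof.
move=> /closure_nrmP Sx /closure_nrmP Sx'; apply/closure_nrmP => e e0.
have c1 : 0 < 1 + nrm c by apply: lt_le_trans ltr01 _; rewrite lerDl nrm_ge0.
have [a Sa xa] := Sx _ (divr_gt0 (divr_gt0 e0 (ltr0Sn R 1)) c1).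
have [a' Sa' xa'] := Sx' _ (divr_gt0 e0 (ltr0Sn R 1)).
exists (c *: a + a'); first exact: lspan_linear.
have -> : c *: x + x' - (c *: a + a') = c *: (x - a) + (x' - a').
  by rewrite scalerBr opprD addrACA.
apply: le_trans (nrmD _ _) _; rewrite nrmZ.
have : nrm c * nrm (x - a) <= (1 + nrm c) * (e / 2 / (1 + nrm c)).
  by rewrite ler_pM ?nrm_ge0// lerDr.
rewrite [(1 + nrm c) * _]mulrC divfK ?gt_eqF//; lra.
Qed.

(* The extension is the closure of the graph of [u j |-> v j]. *)
Lemma bounded_extension (V : completeNormedModType C) (J : Type) (P : J -> Prop)
    (u v : J -> V) (D : R) : 0 <= D ->
  (forall m (c : 'I_m -> C) (s : 'I_m -> J), (forall i, P (s i)) ->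
    nrm (\sum_(i < m) c i *: v (s i)) <= D * nrm (\sum_(i < m) c i *: u (s i))) ->
  let U := closure (lspan [set u j | j in P]) in
  exists B : V -> V,
    [/\ forall c x x', U x -> U x' -> B (c *: x + x') = c *: B x + B x',
        forall j, P j -> B (u j) = v j,
        forall x, U x -> nrm (B x) <= D * nrm x &
        forall x, U x -> closure (lspan [set v j | j in P]) (B x)].
Proof.
move=> D0 uvD U.
(* A relation, not yet a map: one vector may be several combinations of the [u j]. The hypothesis
   with [D] makes it single-valued, also after closure. *)
pose G a b := exists m (c : 'I_m -> C) (s : 'I_m -> J),
  [/\ forall i, P (s i), a = \sum_(i < m) c i *: u (s i) & b = \sum_(i < m) c i *: v (s i)].
have G_lin c a b a' b' : G a b -> G a' b' -> G (c *: a + a') (c *: b + b').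
  move=> [m [d [s [sS -> ->]]]] [m' [d' [s' [s'S -> ->]]]].
  have [e [t [tS E]]] := combination_concat V c d d' sS s'S.
  by exists (m + m')%N, e, t; split.
have G_le a b : G a b -> nrm b <= D * nrm a.
  by move=> [m [d [s [sS -> ->]]]]; exact: uvD.
have G_v a b : G a b -> lspan [set v j | j in P] b.
  move=> [m [d [s [sS _ ->]]]]; exists m, d, (v \o s); split=> // i.
  by exists (s i).
have G_u a : lspan [set u j | j in P] a -> exists b, G a b.
  move=> [m [d [s [sS ->]]]].
  have /choice[t tE] : forall i, exists j, P j /\ u j = s i.
    by move=> i; have [j Pj <-] := sS i; exists j.
  exists (\sum_(i < m) d i *: v (t i)), m, d, t; split=> [i||//].
    by have [] := tE i.
  by apply: eq_bigr => i _; have [_ ->] := tE i.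
have G_dist a b a' b' : G a b -> G a' b' -> nrm (b - b') <= D * nrm (a - a').
  move=> Gab Gab'; apply: G_le.
  by have := G_lin (-1) _ _ _ _ Gab' Gab; rewrite !scaleN1r ![- _ + _]addrC.
pose Gc x z := forall e : R, 0 < e ->
  exists a b, [/\ G a b, nrm (x - a) <= e & nrm (z - b) <= e].
have Gc_lin c x z x' z' : Gc x z -> Gc x' z' -> Gc (c *: x + x') (c *: z + z').
  move=> Gxz Gxz' e e0.
  have c1 : 0 < 1 + nrm c by apply: lt_le_trans ltr01 _; rewrite lerDl nrm_ge0.
  have [a [b [Gab xa zb]]] := Gxz _ (divr_gt0 (divr_gt0 e0 (ltr0Sn R 1)) c1).
  have [a' [b' [Gab' xa' zb']]] := Gxz' _ (divr_gt0 e0 (ltr0Sn R 1)).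
  have small (p q p' q' : V) : nrm (p - q) <= e / 2 / (1 + nrm c) -> nrm (p' - q') <= e / 2 ->
      nrm (c *: p + p' - (c *: q + q')) <= e.
    move=> pq pq'; have -> : c *: p + p' - (c *: q + q') = c *: (p - q) + (p' - q') :> V.
      by rewrite scalerBr opprD addrACA.
    apply: le_trans (nrmD _ _) _; rewrite nrmZ.
    have : nrm c * nrm (p - q) <= (1 + nrm c) * (e / 2 / (1 + nrm c)).
      by rewrite ler_pM ?nrm_ge0// lerDr.
    rewrite [(1 + nrm c) * _]mulrC divfK ?gt_eqF//; lra.
  by exists (c *: a + a'), (c *: b + b'); split; [exact: G_lin|exact: small|exact: small].
have D1 : 0 < 1 + D by lra.
have Gc_le x z : Gc x z -> nrm z <= D * nrm x.
  move=> Gxz; apply/ler_addgt0Pr => e e0.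
  have [a [b [Gab xa zb]]] := Gxz _ (divr_gt0 e0 D1).
  have := G_le _ _ Gab; have := nrmB_le b z 0; rewrite !subr0.
  have := nrmB_le x a 0; rewrite !subr0 nrmBC => H1.
  have := ler_wpM2l D0 H1; have := ler_wpM2l D0 xa.
  move: zb; set d := e / (1 + D) => zb.
  have -> : e = d + D * d by rewrite -{1}(mulrC d) -{1}[d]mulr1 -mulrDr divfK ?gt_eqF.
  lra.
have Gc_uniq x z z' : Gc x z -> Gc x z' -> z = z'.
  move=> Gz Gz'; have := Gc_lin (-1) _ _ _ _ Gz Gz'.
  rewrite !scaleN1r addNr => /Gc_le; rewrite nrm0 mulr0 => H.
  apply/esym/eqP; rewrite -subr_eq0 -nrm_eq0 eq_le nrm_ge0 andbT.
  by rewrite addrC.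
(* Approximants of [x] within 1/(k+1) have images that form a Cauchy sequence by [G_dist];
   completeness gives the value. *)
have Gc_ex x : U x -> exists z, Gc x z.
  move=> /closure_nrmP Ux.
  have /choice[a Ha] : forall k : nat, exists a, lspan [set u j | j in P] a /\
      nrm (x - a) <= k.+1%:R^-1.
    by move=> k; have [a] := Ux k.+1%:R^-1 ltac:(by rewrite invr_gt0); exists a.
  have /choice[b Gb] : forall k, exists b, G (a k) b.
    by move=> k; apply: G_u; case: (Ha k).
  have inv_small (d : R) : 0 < d -> exists N, forall k, (N <= k)%N -> k.+1%:R^-1 <= d.
    move=> d0; exists (Num.truncn d^-1) => k Nk.
    rewrite invf_ple ?posrE//; apply: ltW; apply: lt_le_trans (truncnS_gt _) _.
    by rewrite ler_nat.
  have [e e0|z Hz] := @nrm_cauchy_cvg R V b.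
    have [N HN] := inv_small _ (divr_gt0 (divr_gt0 e0 (ltr0Sn R 1)) D1).
    exists N => n Nn; apply: le_trans (G_dist _ _ _ _ (Gb n) (Gb N)) _.
    have H1 := le_trans (Ha n).2 (HN _ Nn); have H2 := le_trans (Ha N).2 (HN _ (leqnn N)).
    have H3 : nrm (a n - a N) <= e / (1 + D).
      by apply: le_trans (nrmB_le x _ _) _; rewrite nrmBC; lra.
    rewrite -[leRHS](divfK (lt0r_neq0 D1)) mulrC ler_pM ?nrm_ge0//; lra.
  exists z => e e0; have [N HN] := (cvgn_nrmP _ _).1 Hz _ e0.
  have [M HM] := inv_small _ e0.
  exists (a (maxn N M)), (b (maxn N M)); split=> //.
    exact: le_trans (Ha _).2 (HM _ (leq_maxr _ _)).
  by rewrite nrmBC; apply: HN; exact: leq_maxl.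
pose B x := xget 0 [set z | Gc x z].
have GB x : U x -> Gc x (B x).
  by move=> /Gc_ex[z xz]; rewrite /B; case: xgetP => [//|/(_ z)].
have BE x z : U x -> Gc x z -> B x = z by move=> Ux; apply: Gc_uniq; exact: GB.
exists B; split.
- move=> c x x' Ux Ux'; apply: BE; first exact: closure_lspan_linear.
  by apply: Gc_lin; exact: GB.
- move=> j Pj; apply: BE => [|e e0]; first by apply/subset_closure/lspan_sub; exists j.
  exists (u j), (v j); rewrite !subrr !nrm0; split; rewrite ?ltW//.
  by exists 1%N, (fun=> 1), (fun=> j); split; rewrite // big_ord1 scale1r.
- by move=> x /GB/Gc_le.
- move=> x /GB GxB; apply/closure_nrmP => e /GxB[a [b [/G_v vb _ Bb]]].
  by exists b.
Qed.

(* Schur's product theorem, by induction on the number of nonzero [v i]: a nonzero [v l] is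
   projected away. *)
Lemma schur_product (H : hilbertType R) m (p : 'I_m -> 'I_m -> C) (v : 'I_m -> H) :
  (forall c : 'I_m -> C, 0 <= re (\sum_i \sum_j c i * Num.conj (c j) * p i j)) ->
  0 <= re (\sum_i \sum_j p i j * inner (v i) (v j)).
Proof.
move=> ppos; have [n] := ubnP #|[pred i | v i != 0]|; elim: n v => // n IH v.
rewrite ltnS => vn; have [[l vl]|/forallNP v0] := pselect (exists l, v l != 0); last first.
  rewrite big1 => [|i _]; first by rewrite raddf0.
  rewrite big1 // => j _; have /negP := v0 i; rewrite negbK => /eqP ->.
  by rewrite inner0l mulr0.
set s := nrm (v l) ^+ 2; have s0 : s != 0 by rewrite expf_neq0// nrm_eq0.
pose a i := inner (v i) (v l).
(* The component of [v i] orthogonal to [v l]. The part removed contributes the form of [p] at [a],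
   nonnegative by hypothesis, and [w l] vanishes, so fewer nonzero vectors are left. *)
pose w i := v i - (s^-1%:C%C * a i) *: v l.
have vE i j : inner (v i) (v j) = inner (w i) (w j) + s^-1%:C%C * (a i * Num.conj (a j)).
  rewrite /w !(innerDl, innerDr, innerNl, innerNr, innerZl, innerZr) innerxx -/s.
  rewrite (innerC (v l)) -/(a i) -/(a j) rmorphM /=.
  have -> : Num.conj (s^-1%:C%C) = s^-1%:C%C :> C by apply/CrealP; rewrite complex_real.
  have -> : s%:C%C = (s^-1%:C%C)^-1 :> C by rewrite fmorphV invrK.
  have sv0 : s^-1%:C%C != 0 :> C by rewrite eq_complex /= eqxx andbT invr_eq0.
  rewrite [_ * Num.conj (a j) / _]mulrAC divff// mul1r; ring.
have -> : \sum_i \sum_j p i j * inner (v i) (v j) =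
  \sum_i \sum_j p i j * inner (w i) (w j) +
  s^-1%:C%C * \sum_i \sum_j a i * Num.conj (a j) * p i j.
  rewrite mulr_sumr -big_split /=; apply: eq_bigr => i _.
  rewrite mulr_sumr -big_split /=; apply: eq_bigr => j _.
  by rewrite vE; ring.
rewrite raddfD /= Re_realM addr_ge0//; last by rewrite mulr_ge0// invr_ge0 sqr_ge0.
apply: IH; apply: leq_trans vn; apply: proper_card; apply/fintype.properP; split.
  apply/fintype.subsetP => i; rewrite !inE; apply: contraNN => /eqP vi.
  by rewrite /w /a vi inner0l mulr0 scale0r subr0.
exists l; rewrite !inE// negbK /w /a innerxx -/s -rmorphM mulVf// scale1r.
by rewrite subrr.
Qed.

End closed_span.

(** * Elementary tensors *)

Section linear_maps.
Variables (R : realType) (V W : lmodType R[i]) (A : V -> W).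
Hypothesis linA : forall c x x', A (c *: x + x') = c *: A x + A x'.

Lemma linear_map0 : A 0 = 0.
Proof. by have := linA (-1) 0 0; rewrite !scaleN1r !addNr. Qed.

Lemma linear_map_sum (I : Type) (s : seq I) (c : I -> R[i]) (x : I -> V) :
  A (\sum_(i <- s) c i *: x i) = \sum_(i <- s) c i *: A (x i).
Proof.
by elim: s => [|i s IH]; rewrite ?big_nil ?linear_map0// !big_cons linA IH.
Qed.

End linear_maps.

Section tensors.
Variables (R : realType) (H : nat -> hilbertType R) (X : complete_tensor H).
Local Notation C := R[i].
Local Notation re := complex.Re.
Implicit Types (f g h y : forall n, H n) (F : {fset nat}).

Definition C0_class y h : Prop := C0_seq h /\ C0_equiv h y.

Lemma C0_class_refl y : C0_seq y -> C0_class y y.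
Proof. by move=> y0; split=> //; exact: C0_equiv_refl. Qed.

Lemma C0_class_equiv y h f : C0_seq y -> C0_class y h -> C0_class y f -> C0_equiv h f.
Proof.
by move=> y0 [h0 hy] [f0 fy]; exact: C0_equiv_trans h0 y0 f0 hy (C0_equiv_sym fy).
Qed.

Lemma C0_class_modif y h h' F : C0_class y h -> (forall n, n \notin F -> h' n = h n) ->
  C0_class y h'.
Proof.
move=> [/C0_seqP h0 /C0_equivP hy] hh'; split.
  by apply/C0_seqP; apply: summable_modif h0 => n /hh' ->.
by apply/C0_equivP; apply: summable_modif hy => n /hh' ->.
Qed.

Lemma tensor_inner h f : C0_seq h -> C0_seq f ->
  inner (tensor X h) (tensor X f) = qprod (fun n => inner (h n) (f n)).
Proof. by move=> /C0_C_seq h0 /C0_C_seq f0; exact: ctensor_map_inner. Qed.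

Lemma nrm_tensor h : C0_seq h -> nrm (tensor X h) = rprod (fun n => nrm (h n)).
Proof.
move=> h0; have hs := (C0_seqP h).1 h0.
have : (nrm (tensor X h) ^+ 2)%:C%C = (rprod (fun n => nrm (h n)) ^+ 2)%:C%C :> C.
  rewrite -innerxx (tensor_inner h0 h0) rmorphXn /= -qprod_real// expr2.
  rewrite -qprodM; [|exact: near1_real|exact: near1_real].
  by congr qprod; apply/funext => n; rewrite innerxx rmorphXn expr2.
move=> /(congr1 (@complex.Re R)) /= /eqP; rewrite eqrXn2// ?nrm_ge0//; first by move/eqP.
by apply: rprod_ge0 => // n; exact: nrm_ge0.
Qed.

Lemma tensor_inner_off F h f : C0_seq h -> C0_seq f -> C0_equiv h f ->
  inner (tensor X h) (tensor X f) =
  \prod_(n <- F) inner (h n) (f n) * qprod (off F (fun n => inner (h n) (f n))).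
Proof.
by move=> h0 f0 /C0_equivP hf; rewrite (tensor_inner h0 f0) (qprod_off F hf).
Qed.

Definition mix F g f : forall n, H n := fun n => if n \in F then g n else f n.

Lemma mix_out F g f n : n \notin F -> mix F g f n = f n.
Proof. by rewrite /mix => /negbTE ->. Qed.

(** The squared distance is c (p + q - 2 Re r), where c is the product of the |g n|^2 over [F],
    bounded by [D], and p, q, r are the tails of the products of <f,f>, <g,g>, <f,g>, which all tend
    to 1. *)
Lemma tensor_mix_cvg f g (e : R) : C0_seq f -> C0_seq g -> C0_equiv f g -> 0 < e ->
  exists F0, forall F, (F0 `<=` F)%fset -> nrm (tensor X (mix F g f) - tensor X g) <= e.
Proof.
move=> f0 g0 fg e0.
have ff := C0_equiv_refl f0; have gg := C0_equiv_refl g0.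
have [D D0 HD] := near1_prod_bounded ((C0_equivP _ _).1 gg).
(* p + q - 2 Re r involves four tail errors, hence the 4. *)
have d0 : 0 < e ^+ 2 / D / 4 by rewrite !divr_gt0// exprn_gt0.
have [F1 HF1] := qprod_tail ((C0_equivP _ _).1 ff) d0.
have [F2 HF2] := qprod_tail ((C0_equivP _ _).1 gg) d0.
have [F3 HF3] := qprod_tail ((C0_equivP _ _).1 fg) d0.
exists (F1 `|` F2 `|` F3)%fset => F; rewrite !fsubUset => /andP[/andP[/HF1 H1 /HF2 H2] /HF3 H3].
have [m0 mg] : C0_class g (mix F g f).
  exact: C0_class_modif (conj f0 fg) (@mix_out F g f).
have inF z : (forall n, n \in F -> z n = inner (g n) (g n)) ->
    \prod_(n <- F) z n = \prod_(n <- F) inner (g n) (g n).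
  by move=> zE; rewrite !big_seq; apply: eq_bigr => n /zE.
rewrite -ler_sqr ?nnegrE ?nrm_ge0//; last exact: ltW.
rewrite nrmB_sqr.
have nE h : nrm (tensor X h) ^+ 2 = re (inner (tensor X h) (tensor X h)) by rewrite innerxx.
rewrite !nE (tensor_inner_off F m0 m0 (C0_equiv_refl m0)).
rewrite (tensor_inner_off F g0 g0 gg) (tensor_inner_off F m0 g0 mg).
rewrite (inF (fun n => inner (mix F g f n) (mix F g f n))); last first.
  by move=> n nF; rewrite /mix nF.
rewrite (inF (fun n => inner (mix F g f n) (g n))); last by move=> n nF; rewrite /mix nF.
have -> : off F (fun n => inner (mix F g f n) (mix F g f n)) = off F (fun n => inner (f n) (f n)).
  by apply/funext => n; rewrite /off; case: ifP => // nF; rewrite /mix nF.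
have -> : off F (fun n => inner (mix F g f n) (g n)) = off F (fun n => inner (f n) (g n)).
  by apply/funext => n; rewrite /off; case: ifP => // nF; rewrite /mix nF.
move: (HD F) H1 H2 H3.
have -> : \prod_(n <- F) inner (g n) (g n) = (\prod_(n <- F) nrm (g n) ^+ 2)%:C%C :> C.
  by rewrite -prod_realC; apply: eq_bigr => n _; rewrite innerxx.
set c := \prod_(n <- F) _; set p := qprod _; set q := qprod _; set r := qprod _.
have c0 : 0 <= c by apply: prodr_ge0 => n _; rewrite sqr_ge0.
rewrite nrm_real ger0_norm// => cD.
move=> /(le_trans (Re_nrm _)) + /(le_trans (Re_nrm _)) + /(le_trans (Re_nrm _)).
rewrite !raddfB /= !ler_norml => /andP[_ p1] /andP[_ q1] /andP[r1 _].
rewrite !Re_realM.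
have -> : c * re p + c * re q - 2 * (c * re r) = c * (re p + re q - 2 * re r) by ring.
have -> : e ^+ 2 = D * (e ^+ 2 / D) by rewrite mulrCA divff ?mulr1// gt_eqF.
apply: (@le_trans _ _ (c * (e ^+ 2 / D))).
  apply: ler_wpM2l => //; lra.
by apply: ler_wpM2r => //; rewrite divr_ge0// ?sqr_ge0// ltW.
Qed.

Lemma inner_sum2 (V : hilbertType R) m (c d : 'I_m -> C) (u v : 'I_m -> V) :
  inner (\sum_i c i *: u i) (\sum_j d j *: v j) =
  \sum_i \sum_j c i * Num.conj (d j) * inner (u i) (v j).
Proof.
rewrite inner_suml; apply: eq_bigr => i _; rewrite inner_sumr; apply: eq_bigr => j _.
by rewrite innerZl innerZr mulrA.
Qed.

(** The difference of M^2 times the old squared norm and the new one is a double sum of [p i j]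
    times [K i j]. The bound on A makes [p] positive semidefinite, and [K] is, up to a positive
    factor, a Gram matrix; [schur_product] concludes. *)
Lemma one_factor_le y n (A : H n -> H n) (M : R) m (c : 'I_m -> C)
    (h h' : 'I_m -> forall n, H n) :
  (forall d x x', A (d *: x + x') = d *: A x + A x') ->
  0 <= M -> (forall x, nrm (A x) <= M * nrm x) -> C0_seq y ->
  (forall i, C0_class y (h i)) ->
  (forall i k, k != n -> h' i k = h i k) -> (forall i, h' i n = A (h i n)) ->
  nrm (\sum_i c i *: tensor X (h' i)) <= M * nrm (\sum_i c i *: tensor X (h i)).
Proof.
move=> linA M0 MA y0 hy h'h h'n.
pose K i j := qprod (off [fset n]%fset (fun k => inner (h i k) (h j k))).
have KE (g : 'I_m -> forall k, H k) i j : (forall i k, k != n -> g i k = h i k) ->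
    inner (tensor X (g i)) (tensor X (g j)) = inner (g i n) (g j n) * K i j.
  move=> gh.
  have gy l : C0_class y (g l).
    by apply: (C0_class_modif (F := [fset n]%fset) (hy l)) => k; rewrite inE => /gh.
  rewrite (tensor_inner_off [fset n]%fset (gy i).1 (gy j).1); last first.
    exact: C0_class_equiv y0 (gy i) (gy j).
  rewrite big_seq_fset1; congr (_ * qprod _); apply/funext => k; rewrite /off inE.
  by case: (altP (k =P n)) => // kn; rewrite !gh.
(* If [H n] is the zero space, no vector can be frozen in place n, but then all tensors vanish. *)
have [[e e0]|/forallNP e0] := pselect (exists e : H n, e != 0); last first.
  suff -> : \sum_i c i *: tensor X (h' i) = 0 by rewrite nrm0 mulr_ge0 ?nrm_ge0.
  apply/eqP; rewrite -nrm_eq0 -sqrf_eq0; apply/eqP.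
  have : (nrm (\sum_i c i *: tensor X (h' i)) ^+ 2)%:C%C = 0 :> C.
    rewrite -innerxx inner_sum2 big1// => i _; rewrite big1// => j _.
    rewrite (KE h' i j h'h); have /negP := e0 (h' i n); rewrite negbK => /eqP ->.
    by rewrite inner0l mul0r mulr0.
  by move=> /(congr1 (@complex.Re R)) /= ->.
have E0 : 0 < nrm e ^+ 2 by rewrite exprn_gt0// lt_def nrm_eq0 e0 nrm_ge0.
pose p i j := c i * Num.conj (c j) *
  ((M ^+ 2)%:C%C * inner (h i n) (h j n) - inner (A (h i n)) (A (h j n))).
(* Freezing place n at a fixed nonzero [e] realizes [K] as Gram matrix of the [r i], scaled by
   |e|^2. *)
pose r i : X := tensor X (dfwith (h i) n e).
have rE i j : inner (r i) (r j) = (nrm e ^+ 2)%:C%C * K i j.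
  rewrite /r (KE (fun i => dfwith (h i) n e)) ?dfwithin ?innerxx//.
  by move=> l k kn; rewrite dfwithout// eq_sym.
have : forall d : 'I_m -> C,
    0 <= re (\sum_i \sum_j d i * Num.conj (d j) * p i j).
  move=> d; pose z := \sum_i (d i * c i) *: h i n.
  have -> : \sum_i \sum_j d i * Num.conj (d j) * p i j =
      (M ^+ 2)%:C%C * inner z z - inner (A z) (A z).
    rewrite /z (linear_map_sum linA) !inner_sum2 mulr_sumr -sumrB; apply: eq_bigr => i _.
    rewrite mulr_sumr -sumrB; apply: eq_bigr => j _; rewrite /p rmorphM /=; ring.
  rewrite raddfB /= Re_realM !innerxx /= subr_ge0 -exprMn.
  by rewrite lerXn2r// ?nnegrE ?mulr_ge0 ?nrm_ge0.
move=> /(schur_product r).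
have -> : \sum_i \sum_j p i j * inner (r i) (r j) = (nrm e ^+ 2)%:C%C *
    ((M ^+ 2)%:C%C * (nrm (\sum_i c i *: tensor X (h i)) ^+ 2)%:C%C -
     (nrm (\sum_i c i *: tensor X (h' i)) ^+ 2)%:C%C).
  rewrite -!innerxx !inner_sum2 mulr_sumr -sumrB mulr_sumr; apply: eq_bigr => i _.
  rewrite mulr_sumr -sumrB mulr_sumr; apply: eq_bigr => j _.
  rewrite rE (KE h' i j h'h) (KE h i j (fun _ _ _ => erefl)) !h'n [inner e e]innerxx /p; ring.
have reE (u v w t : R) :
    re (u%:C%C * (v%:C%C * w%:C%C - t%:C%C)) = u * (v * w - t).
  by rewrite Re_realM raddfB /= mul0r subr0.
rewrite [X in 0 <= X -> _]reE pmulr_rge0// subr_ge0 -exprMn.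
by rewrite ler_sqr ?nnegrE ?mulr_ge0 ?nrm_ge0.
Qed.

Section factors.
Variables (y : forall n, H n) (A : forall n, H n -> H n) (a : nat -> R).
Arguments A : clear implicits.
Hypothesis y_C0 : C0_seq y.
Hypothesis linA : forall n c x x', A n (c *: x + x') = c *: A n x + A n x'.
Hypothesis a_ge0 : forall n, 0 <= a n.
Hypothesis aA : forall n x, nrm (A n x) <= a n * nrm x.

Lemma finite_factors_le (s : seq nat) m (c : 'I_m -> C) (h : 'I_m -> forall n, H n) :
  uniq s -> (forall i, C0_class y (h i)) ->
  nrm (\sum_i c i *: tensor X (fun n => if n \in s then A n (h i n) else h i n)) <=
  \prod_(n <- s) a n * nrm (\sum_i c i *: tensor X (h i)).
Proof.
move=> + hy; elim: s => [_|k s IH /= /andP[ks us]]; first by rewrite big_nil mul1r.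
rewrite big_cons -mulrA.
apply: (@le_trans _ _ (a k * nrm (\sum_i c i *:
    tensor X (fun n => if n \in s then A n (h i n) else h i n)))).
  apply: (@one_factor_le y k (A k) (a k) _ c _ _ (@linA k) (a_ge0 k) (@aA k) y_C0).
  - move=> i; apply: (C0_class_modif (F := [fset n in s]%fset) (hy i)) => n.
    by rewrite inE => /negbTE ->.
  - by move=> i n nk; rewrite inE (negbTE nk).
  - by move=> i; rewrite inE eqxx (negbTE ks).
by rewrite ler_wpM2l// IH.
Qed.

(** [D] has to bound only the products over sets containing [F1]: with [fset0] this yields a crude
    bound, with a large [F1] the sharp one needed for the norm. A common finite [G] replaces all
    image tensors by mixed ones, to which [finite_factors_le] applies, at a cost of at most [e]. *)
Lemma factors_le (F1 : {fset nat}) (D : R) m (c : 'I_m -> C) (h : 'I_m -> forall n, H n) :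
  (forall F, (F1 `<=` F)%fset -> \prod_(n <- F) a n <= D) ->
  (forall i, C0_class y (h i)) -> (forall i, C0_class y (fun n => A n (h i n))) ->
  nrm (\sum_i c i *: tensor X (fun n => A n (h i n))) <=
  D * nrm (\sum_i c i *: tensor X (h i)).
Proof.
move=> aD hy Ahy; apply/ler_addgt0Pr => e e0.
set S := \sum_i nrm (c i).
have S0 : 0 <= S by apply: sumr_ge0 => i _; exact: nrm_ge0.
have S1 : 0 < 1 + S by lra.
have /choice[F HF] : forall i, exists F0, forall F, (F0 `<=` F)%fset ->
    nrm (tensor X (mix F (fun n => A n (h i n)) (h i)) - tensor X (fun n => A n (h i n)))
    <= e / (1 + S).
  move=> i; apply: tensor_mix_cvg; [exact: (hy i).1|exact: (Ahy i).1| |exact: divr_gt0].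
  exact: C0_class_equiv y_C0 (hy i) (Ahy i).
have [G FG] : exists G : {fset nat}, (F1 `<=` G)%fset /\ forall i, (F i `<=` G)%fset.
  exists (F1 `|` \bigcup_(i <- enum 'I_m) F i)%fset; rewrite fsubsetUl; split=> // i.
  apply/fsubsetU/orP; right; apply: bigfcup_sup => //; exact: mem_enum.
have -> : \sum_i c i *: tensor X (fun n => A n (h i n)) =
  \sum_i c i *: tensor X (mix G (fun n => A n (h i n)) (h i)) -
  \sum_i c i *: (tensor X (mix G (fun n => A n (h i n)) (h i)) -
                 tensor X (fun n => A n (h i n))).
  by rewrite -sumrB; apply: eq_bigr => i _; rewrite scalerBr opprB addrC subrK.
apply: le_trans (nrmD _ _) _; rewrite nrmN; apply: lerD.
  apply: le_trans (finite_factors_le c (fset_uniq G) hy) _.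
  by rewrite ler_wpM2r ?nrm_ge0// aD// FG.1.
apply: le_trans (nrm_sum _ _ _) _.
apply: (@le_trans _ _ (\sum_i nrm (c i) * (e / (1 + S)))).
  by apply: ler_sum => i _; rewrite nrmZ ler_wpM2l ?nrm_ge0// HF// FG.2.
rewrite -mulr_suml -/S -[leRHS](divfK (lt0r_neq0 S1)) mulrC ler_wpM2l//; last lra.
by rewrite ltW// divr_gt0.
Qed.

End factors.

Lemma tensor_in_class y h : C0_class y h -> incomplete_tensor X y (tensor X h).
Proof. by move=> hy; apply/subset_closure/lspan_sub; exists h. Qed.

(* A sequence not equivalent to [y] has a tensor orthogonal to those in the class of [y]. *)
Lemma C0_class_of_tensor y h : C0_seq y -> C_seq h ->
  incomplete_tensor X y (tensor X h) -> tensor X h != 0 -> C0_class y h.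
Proof.
move=> y0 hC hy h_neq0.
(* A nonzero value of [qprod] cannot be the default 0, so it is an unconditional limit. *)
have near1_of_inner f : C_seq f -> inner (tensor X h) (tensor X f) != 0 ->
    near1 (fun n => inner (h n) (f n)).
  move=> fC; rewrite [inner _ _](ctensor_map_inner X hC fC) /qprod.
  by case: xgetP => [a _ ha a0|]; [exact: uncond_prod_near1 ha a0|rewrite eqxx].
have h0 : C0_seq h.
  apply: C0_of_sqr; have : inner (tensor X h) (tensor X h) != 0.
    by rewrite innerxx eq_complex /= eqxx andbT expf_neq0// nrm_eq0.
  move=> /(near1_of_inner _ hC); apply: summable_seq_le => n.
  by rewrite innerxx -(rmorph1 (real_complex R)) -rmorphB nrm_real.
refine (conj h0 _); apply: contrapT => nhy.
have orth f : C0_class y f -> inner (tensor X f) (tensor X h) = 0.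
  move=> [f0 fy]; apply/eqP; apply: contraT => hf; exfalso; apply: nhy.
  have /(near1_of_inner _ (C0_C_seq f0))/C0_equivP hf' : inner (tensor X h) (tensor X f) != 0.
    by rewrite innerC conjC_eq0.
  exact: C0_equiv_trans h0 f0 y0 hf' fy.
have nh : 0 < nrm (tensor X h) by rewrite lt_def nrm_eq0 h_neq0 nrm_ge0.
(* An element of the span within half the norm of the tensor, yet orthogonal to it, contradicts
   Pythagoras. *)
move/closure_nrmP : hy => /(_ _ (divr_gt0 nh (ltr0Sn R 1)))[s [m [c [t [tP ->]]]]].
apply/negP; rewrite -ltNge -ltr_sqr ?nnegrE ?nrm_ge0//; last by lra.
rewrite nrmB_sqr re_innerC inner_suml.
have -> : \sum_(i < m) inner (c i *: t i) (tensor X h) = 0.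
  by apply: big1 => i _; rewrite innerZl; have [f fy <-] := tP i; rewrite (orth f fy) mulr0.
rewrite raddf0 mulr0 subr0.
have := sqr_ge0 (nrm (\sum_(i < m) c i *: t i)).
have : 0 < nrm (tensor X h) ^+ 2 by rewrite exprn_gt0.
rewrite exprMn; lra.
Qed.

(** [is_tensor_op] also tests C-sequences with zero tensor, which need not be C_0-sequences; the
    product of their norms is the property that passes to images. *)
Lemma tensor_eq0P h : C_seq h ->
  tensor X h = 0 <-> uncond_prod (fun n => `|h n| : C) 0.
Proof.
move=> hC; split=> [h0|h0].
  have [p hp] : exists p : C, uncond_prod (fun n => `|h n|) p := hC.
  suff <- : p = 0 by [].
  apply/eqP; apply: contraT => p0; have hs := uncond_prod_near1 hp p0.
  have {}hs := C0_of_near1 hs.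
  have := nrm_tensor hs; rewrite h0 nrm0 => r0.
  have rs := (C0_seqP h).1 hs.
  have := nprod_uncond_prod (near1_nprod (near1_real rs)); rewrite qprod_real// -r0.
  have <- : (fun n => `|h n| : C) = (fun n => (nrm (h n))%:C%C).
    by apply/funext => n; rewrite nrmE.
  by move=> /(uncond_prod_unique hp) pE; move: p0; rewrite pE eqxx.
suff : inner (tensor X h) (tensor X h) = 0.
  by rewrite innerxx => /(congr1 (@complex.Re R))/eqP /=; rewrite expf_eq0 nrm_eq0 => /eqP.
rewrite [inner _ _](ctensor_map_inner X hC hC).
suff h2 : uncond_prod (fun n => inner (h n) (h n)) 0.
  by rewrite /qprod; case: xgetP => [b _ /(uncond_prod_unique h2)|].
move=> sigma bij; apply/cvgn_nrmP => e e0.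
(* Once the product P of norms is at most both e and 1, its square is at most e. *)
have m0 : 0 < Num.min e 1 by rewrite lt_min e0 ltr01.
have [N HN] := (cvgn_nrmP _ _).1 (h0 _ bij) _ m0; exists N => n /HN.
rewrite !subr0 !nrm_prod le_min => /andP[P1 P2].
rewrite (eq_bigr (fun i : 'I_n => nrm (`|h (sigma i)| : C) * nrm (`|h (sigma i)| : C))); last first.
  by move=> i _; rewrite -nrmM -expr2 -sqr_norm_inner.
rewrite big_split /= -[e]mulr1; apply: ler_pM => //; apply: prodr_ge0 => i _; exact: nrm_ge0.
Qed.

End tensors.

Arguments tensor_in_class {R H} X {y h} _.

(** * Bounded operators on closed spans *)

Section operators.
Variables (R : realType) (E : hilbertType R).
Local Notation C := R[i].
Implicit Types (V : set E) (A B : E -> E).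

Lemma lspan_ind (W : lmodType C) (S P : set W) : P 0 ->
  (forall c x x', S x -> P x -> P x' -> P (c *: x + x')) -> S `<=` P -> lspan S `<=` P.
Proof.
move=> P0 Plin SP x [m [c [s [sS ->]]]]; elim: m c s sS => [|m IH] c s sS.
  by rewrite big_ord0.
rewrite big_ord_recl; apply: Plin; [exact: sS|exact: SP|].
by apply: (IH (fun i => c (lift ord0 i)) (fun i => s (lift ord0 i))) => i; exact: sS.
Qed.

Definition subspace V : Prop :=
  V 0 /\ forall (c : C) x x', V x -> V x' -> V (c *: x + x').

Lemma subspaceT : subspace [set: E].
Proof. by []. Qed.

Lemma closure_lspan_subspace (S : set E) : subspace (closure (lspan S)).
Proof.
split; first exact/subset_closure/lspan0.
by move=> c x x'; exact: closure_lspan_linear.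
Qed.

Lemma subspaceB V x x' : subspace V -> V x -> V x' -> V (x - x').
Proof. by move=> [_ lV] Vx Vx'; rewrite addrC -scaleN1r; exact: lV. Qed.

Lemma subspaceZ V (c : C) x : subspace V -> V x -> V (c *: x).
Proof. by move=> [V0 lV] Vx; rewrite -[_ *: _]addr0; exact: lV. Qed.

Lemma bounded_op_bound V A : bounded_op V A ->
  exists2 D : R, 0 <= D & forall x, V x -> nrm (A x) <= D * nrm x.
Proof.
(* [M] is an element of [R[i]]; comparing real parts shows that its real part already is a bound. *)
move=> [_ _ [M HM]]; exists `|complex.Re M| => // x /HM.
rewrite !nrmE lecE => /andP[_ H]; apply: le_trans H _.
rewrite mulrC Re_realM mulrC ler_wpM2r ?nrm_ge0//; exact: ler_norm.
Qed.

Lemma bounded_opI V A (D : R) : (forall x, V x -> V (A x)) ->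
  (forall (c : C) x x', V x -> V x' -> A (c *: x + x') = c *: A x + A x') ->
  (forall x, V x -> nrm (A x) <= D * nrm x) -> bounded_op V A.
Proof.
move=> AV linA AD; split=> //; exists D%:C%C => x /AD.
by rewrite !nrmE -rmorphM lecR.
Qed.

Lemma bounded_op0 V A : subspace V -> bounded_op V A -> A 0 = 0.
Proof.
by move=> [V0 _] [_ linA _]; have := linA (-1) 0 0 V0 V0; rewrite !scaleN1r !addNr.
Qed.

Lemma bounded_opB V A x x' : bounded_op V A -> V x -> V x' -> A (x - x') = A x - A x'.
Proof.
move=> [_ linA _] Vx Vx'.
by rewrite addrC -scaleN1r linA// scaleN1r addrC.
Qed.

Lemma bounded_opZ V A (c : C) x : subspace V -> bounded_op V A -> V x ->
  A (c *: x) = c *: A x.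
Proof.
move=> sV bA Vx; have [_ linA _] := bA.
by rewrite -[_ *: x]addr0 linA ?(bounded_op0 sV bA) ?addr0//; case: sV.
Qed.

Section opnorm.
Variables (V : set E) (A : E -> E).
Hypotheses (sV : subspace V) (bA : bounded_op V A).

Lemma opnorm_has_sup : has_sup [set complex.Re `|A x| | x in [set x | V x /\ `|x| <= 1]].
Proof.
split; first by exists (complex.Re `|A 0|), 0 => //; split; [case: sV|rewrite normr0 ler01].
have [D D0 AD] := bounded_op_bound bA; exists D => r [x [Vx x1] <-].
move: x1; rewrite nrmE -(rmorph1 (real_complex R)) lecR => x1.
by apply: le_trans (AD _ Vx) _; rewrite -[leRHS]mulr1 ler_wpM2l.
Qed.

Lemma opnorm_ge0 : 0 <= opnorm V A.
Proof.
apply: ub_le_sup; first by case: opnorm_has_sup.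
exists 0; first by split; [case: sV|rewrite normr0 ler01].
by rewrite (bounded_op0 sV bA) normr0.
Qed.

Lemma opnorm_le x : V x -> nrm (A x) <= opnorm V A * nrm x.
Proof.
move=> Vx; have [->|x0] := eqVneq x 0.
  by rewrite (bounded_op0 sV bA) !nrm0 mulr0.
have nx : 0 < nrm x by rewrite lt_def nrm_eq0 x0 nrm_ge0.
rewrite -ler_pdivrMr//; apply: ub_le_sup; first by case: opnorm_has_sup.
exists ((nrm x)^-1%:C%C *: x).
  split; first exact: subspaceZ.
  rewrite nrmE -(rmorph1 (real_complex R)) lecR nrmZ nrm_real ger0_norm ?invr_ge0 ?nrm_ge0//.
  by rewrite mulVf ?gt_eqF.
rewrite -/(nrm _) (bounded_opZ _ sV bA Vx) nrmZ nrm_real ger0_norm ?invr_ge0 ?nrm_ge0//.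
exact: mulrC.
Qed.

Lemma opnorm_lub (K : R) : (forall x, V x -> nrm x <= 1 -> nrm (A x) <= K) ->
  opnorm V A <= K.
Proof.
move=> AK; apply: ge_sup; first by case: opnorm_has_sup.
move=> r [x [Vx x1] <-]; apply: AK => //.
by move: x1; rewrite nrmE -(rmorph1 (real_complex R)) lecR.
Qed.

End opnorm.

Section closed_span_ops.
Variable S : set E.
Local Notation V := (closure (lspan S)).
Variable A : E -> E.
Hypothesis bA : bounded_op V A.

(** Boundedness of [A] on the closure, with whatever constant [D'], makes the error of approximating
    from the span negligible. *)
Lemma bounded_op_le_closure (D : R) : 0 <= D ->
  (forall x, lspan S x -> nrm (A x) <= D * nrm x) -> forall x, V x -> nrm (A x) <= D * nrm x.
Proof.
move=> D0 AD x Vx; have [D' D'0 AD'] := bounded_op_bound bA.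
apply/ler_addgt0Pr => e e0.
have K0 : 0 < 1 + D' + D by lra.
have [s Ss xs] := (closure_nrmP _ _).1 Vx _ (divr_gt0 e0 K0).
have Vs : V s by exact: subset_closure.
have H1 := nrmB_le (A s) (A x) 0; rewrite !subr0 -(bounded_opB bA Vx Vs) in H1.
have H2 := AD' _ (subspaceB (closure_lspan_subspace S) Vx Vs).
have H3 := nrmB_le x s 0; rewrite !subr0 nrmBC in H3.
have H4 := ler_wpM2l D'0 xs; have H5 := ler_wpM2l D0 xs; have H6 := ler_wpM2l D0 H3.
have H7 := AD _ Ss.
have : e = e / (1 + D' + D) * (1 + D' + D) by rewrite divfK ?gt_eqF.
have : 0 < e / (1 + D' + D) by rewrite divr_gt0.
by move: H4 H5 xs; set d := e / _; rewrite !mulrDr mulr1; lra.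
Qed.

Lemma bounded_op_vanish : (forall s, S s -> A s = 0) -> forall x, V x -> A x = 0.
Proof.
move=> AS x Vx; apply/eqP; rewrite -nrm_eq0 eq_le nrm_ge0 andbT -[leRHS](mul0r (nrm x)).
apply: (bounded_op_le_closure (lexx 0)) Vx => {}x.
suff H : lspan S `<=` [set s | V s /\ A s = 0] by move=> /H[_ ->]; rewrite nrm0 mul0r.
have [V0 linV] := closure_lspan_subspace S.
apply: lspan_ind => [|c u v _ [Vu Au] [Vv Av]|s Ss].
- by split=> //; exact: bounded_op0 (closure_lspan_subspace S) bA.
- split; first exact: linV.
  by have [_ linA _] := bA; rewrite linA// Au Av scaler0 addr0.
- by split; [apply/subset_closure/lspan_sub|exact: AS].
Qed.

End closed_span_ops.

Lemma bounded_op_eq_closure (S : set E) A B :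
  bounded_op (closure (lspan S)) A -> bounded_op (closure (lspan S)) B ->
  (forall s, S s -> A s = B s) -> forall x, closure (lspan S) x -> A x = B x.
Proof.
move=> bA bB AB x Vx; apply/eqP; rewrite -subr_eq0; apply/eqP.
have [AV linA _] := bA; have [BV linB _] := bB.
have [D D0 AD] := bounded_op_bound bA; have [D' D'0 BD] := bounded_op_bound bB.
suff bAB : bounded_op (closure (lspan S)) (fun x => A x - B x).
  by apply: (bounded_op_vanish bAB) Vx => s /AB ->; rewrite subrr.
apply: (@bounded_opI _ _ (D + D')) => [{Vx}x Vx|c u v Vu Vv|{Vx}x Vx].
- exact: (subspaceB (closure_lspan_subspace S) (AV _ Vx) (BV _ Vx)).
- by rewrite linA// linB// scalerBr opprD addrACA.
- apply: le_trans (nrmD _ _) _; rewrite nrmN mulrDl lerD//; [exact: AD|exact: BD].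
Qed.

Lemma bounded_op_comp V A B : bounded_op V A -> bounded_op V B ->
  bounded_op V (fun x => A (B x)).
Proof.
move=> bA bB; have [AV linA _] := bA; have [BV linB _] := bB.
have [D D0 AD] := bounded_op_bound bA; have [D' D'0 BD] := bounded_op_bound bB.
apply: (@bounded_opI _ _ (D * D')) => [x Vx|c u v Vu Vv|x Vx].
- exact/AV/BV.
- by rewrite linB// linA//; exact: BV.
- by apply: le_trans (AD _ (BV _ Vx)) _; rewrite -mulrA ler_wpM2l// BD.
Qed.

Lemma bounded_op_id V : bounded_op V id.
Proof. by apply: (@bounded_opI _ _ 1) => // x _; rewrite mul1r. Qed.

End operators.

(** * Tensor products of operators *)

Section max_products.
Variable R : realType.
Implicit Types a M r : nat -> R.

Lemma real_prod_bounded r : summable_seq (fun n => 1 - r n) ->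
  exists2 D : R, 0 < D & forall F : {fset nat}, `|\prod_(n <- F) r n| <= D.
Proof.
move=> /near1_real/near1_prod_bounded[D D0 HD]; exists D => // F.
by rewrite -nrm_real -prod_realC.
Qed.

Lemma real_prod_tail r (e : R) : summable_seq (fun n => 1 - r n) -> 0 < e ->
  exists F0 : {fset nat}, forall F : {fset nat}, [disjoint F & F0]%fset ->
    `|\prod_(n <- F) r n - 1| <= e.
Proof.
move=> /near1_real rs /(near1_tail rs)[F0 HF0]; exists F0 => F /HF0.
by rewrite prod_realC -(rmorph1 (real_complex R)) -rmorphB nrm_real.
Qed.

Lemma sum_le_prod M (s : seq nat) : (forall n, 1 <= M n) ->
  \sum_(n <- s) (M n - 1) <= \prod_(n <- s) M n - 1.
Proof.
move=> M1; elim: s => [|k s IH]; first by rewrite !big_nil subrr.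
rewrite !big_cons; move: IH; set S := \sum_(_ <- _) _; set P := \prod_(_ <- _) _ => IH.
have S0 : 0 <= S by apply: sumr_ge0 => n _; rewrite subr_ge0.
have : 0 <= (M k - 1) * (P - 1) by rewrite mulr_ge0 ?subr_ge0//; lra.
lra.
Qed.

Lemma summable_of_prod_le M (K : R) : (forall n, 1 <= M n) ->
  (forall F : {fset nat}, \prod_(n <- F) M n <= K) -> summable_seq (fun n => 1 - M n).
Proof.
move=> M1 MK; exists K => F; apply: le_trans (MK F).
have := sum_le_prod F M1.
rewrite (eq_bigr (fun n => `|1 - M n|)) => [|n _]; first lra.
by rewrite ler0_norm ?opprB// subr_le0.
Qed.

Lemma summable_of_uncond_prod M (p : R) : (forall n, 1 <= M n) ->
  uncond_prod M p -> summable_seq (fun n => 1 - M n).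
Proof.
move=> M1 Mp; have bij : bijective (@id nat) by exists id.
move/cvgrPdist_le : (Mp _ bij) => /(_ _ ltr01)[N _ HN].
apply: (@summable_of_prod_le _ (p + 1)) => // F.
have [L HL] := fset_bound F.
have FL : (F `<=` fseg (maxn L N))%fset.
  by apply/fsubsetP => n /HL nL; rewrite in_fseg (leq_trans nL)// leq_maxl.
apply: (@le_trans _ _ (\prod_(n <- fseg (maxn L N)) M n)).
  rewrite (prod_fset_split _ FL) -[leLHS]mulr1 ler_wpM2l//.
    by apply: prodr_ge0 => n _; apply: le_trans ler01 (M1 n).
  have := sum_le_prod (fseg (maxn L N) `\` F)%fset M1.
  have : 0 <= \sum_(n <- (fseg (maxn L N) `\` F)%fset) (M n - 1).
    by apply: sumr_ge0 => n _; rewrite subr_ge0.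
  lra.
have /= := HN _ (leq_maxr L N); rewrite prod_fseg distrC ler_norml => /andP[_]; lra.
Qed.

(** A product of the maxima over [F] equals the product of the [a n] over those n in [F] with 1 <= a
    n, to which the hypothesis applies. *)
Lemma prod_max1_le a (K : R) : (forall n, 0 <= a n) ->
  (forall F : {fset nat}, \prod_(n <- F) a n <= K) ->
  forall F : {fset nat}, \prod_(n <- F) Num.max 1 (a n) <= K.
Proof.
move=> a0 aK F; apply: le_trans (aK [fset n in F | 1 <= a n]%fset).
rewrite (big_fsetID _ (fun n => 1 <= a n)) /= [X in _ * X]big_seq [X in _ * X]big1 ?mulr1.
  rewrite big_seq [leRHS]big_seq; apply: ler_prod => n; rewrite !inE /= => /andP[_ n1].
  by rewrite max_r// lexx (le_trans ler01 n1).
by move=> n; rewrite !inE /= => /andP[_]; rewrite -ltNge => /ltW n1; rewrite max_l.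
Qed.

End max_products.

Section factor_operators.
Variables (R : realType) (H : nat -> hilbertType R) (X : complete_tensor H).
Local Notation C := R[i].
Local Notation re := complex.Re.
Variables (y : forall n, H n) (A : forall n, H n -> H n).
Arguments A : clear implicits.
Hypothesis y_C0 : C0_seq y.
Hypothesis A_bounded : forall n, bounded_op [set: H n] (A n).
Implicit Types (g h : forall n, H n) (F : {fset nat}) (B : X -> X).
Local Notation V := (incomplete_tensor X y).
Local Notation a := (fun n => opnorm [set: H n] (A n)).
Local Notation M := (fun n => Num.max 1 (opnorm [set: H n] (A n))).

Lemma factor_linear n (c : C) x x' : A n (c *: x + x') = c *: A n x + A n x'.
Proof. by have [_ linA _] := A_bounded n; exact: linA. Qed.

Lemma factor_norm_ge0 n : 0 <= a n.
Proof. exact: opnorm_ge0 (subspaceT _) (A_bounded n). Qed.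

Lemma factor_norm_le n x : nrm (A n x) <= a n * nrm x.
Proof. by apply: opnorm_le (subspaceT _) (A_bounded n) _ _. Qed.

Lemma factor_max_le n x : nrm (A n x) <= M n * nrm x.
Proof.
apply: le_trans (factor_norm_le _) _.
by rewrite ler_wpM2r ?nrm_ge0// le_max lexx orbT.
Qed.

Lemma max1_ge1 n : 1 <= M n.
Proof. by rewrite le_max lexx. Qed.

Lemma subspace_incomplete : subspace V.
Proof. exact: closure_lspan_subspace. Qed.

(** The supremum over unit balls is taken one coordinate at a time, so no error terms arise; [c]
    collects the factors whose vector is already fixed. *)
Lemma sup_prod_le (s : seq nat) (c K : R) : uniq s -> 0 <= c ->
  (forall v : forall n, H n, (forall n, nrm (v n) <= 1) ->
     c * \prod_(n <- s) nrm (A n (v n)) <= K) ->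
  c * \prod_(n <- s) a n <= K.
Proof.
elim: s c => [|k s IH] c.
  by move=> _ _ /(_ (fun=> 0)); rewrite !big_nil; apply => n; rewrite nrm0 ler01.
move=> /= /andP[ks us] c0 HK; rewrite big_cons.
set p := \prod_(n <- s) _.
have p0 : 0 <= p by apply: prodr_ge0 => n _; exact: factor_norm_ge0.
have HxK x : nrm x <= 1 -> (c * nrm (A k x)) * p <= K.
  move=> x1; apply: IH => // [|v v1]; first by rewrite mulr_ge0 ?nrm_ge0.
  have := HK (dfwith v k x); rewrite big_cons dfwithin mulrA.
  have -> : \prod_(n <- s) nrm (A n (dfwith v k x n)) = \prod_(n <- s) nrm (A n (v n)).
    rewrite big_seq [RHS]big_seq; apply: eq_bigr => n ns; rewrite dfwithout//.
    by apply: contraNneq ks => ->.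
  apply=> n; case: (eqVneq k n) => [<-|kn]; first by rewrite dfwithin.
  by rewrite dfwithout.
have K0 : 0 <= K.
  have := HxK 0; rewrite nrm0 => /(_ ler01); apply: le_trans.
  by rewrite !mulr_ge0 ?nrm_ge0.
rewrite mulrA mulrAC mulrC; have [cp0|cp0] := eqVneq (c * p) 0.
  by rewrite cp0 mulr0.
have cp : 0 < c * p by rewrite lt_def cp0 mulr_ge0.
rewrite -ler_pdivlMr//; apply: opnorm_lub (subspaceT _) (A_bounded k) _ _ => x _ x1.
by rewrite ler_pdivlMr// mulrCA mulrA HxK.
Qed.

(** [B] is tested on [g] with its coordinates in [F] replaced by arbitrary vectors of the unit
    balls; the two tails stay those of [g] and of its image. The base point is left free: it is [y]
    for the norm formula, and a sequence with nonzero image for necessity. *)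
Lemma tensor_op_lower B (b : R) g F : 0 <= b ->
  (forall x, V x -> nrm (B x) <= b * nrm x) ->
  (forall h, C0_class y h -> B (tensor X h) = tensor X (fun n => A n (h n))) ->
  C0_class y g -> C0_class y (fun n => A n (g n)) ->
  rprod (off F (fun n => nrm (A n (g n)))) * \prod_(n <- F) a n <=
  b * rprod (off F (fun n => nrm (g n))).
Proof.
move=> b0 Bb BA gy Agy.
have Ags := (C0_seqP _).1 Agy.1; have gs := (C0_seqP _).1 gy.1.
have off_ge0 (u : forall n, H n) n : 0 <= off F (fun n => nrm (u n)) n.
  by rewrite /off; case: ifP => // _; exact: nrm_ge0.
apply: sup_prod_le; first exact: fset_uniq.
  by apply: rprod_ge0; [exact: summable_off|exact: (off_ge0 (fun n => A n (g n)))].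
move=> v v1; pose h := mix F v g.
have hy : C0_class y h := C0_class_modif gy (@mix_out _ _ F v g).
have Ahy : C0_class y (fun n => A n (h n)).
  by apply: (C0_class_modif (F := F) Agy) => n nF; rewrite /h mix_out.
have := Bb _ (tensor_in_class X hy); rewrite (BA _ hy).
rewrite (nrm_tensor X Ahy.1) (nrm_tensor X hy.1).
rewrite (rprod_off F) ?(C0_seqP _).1; [|exact: (C0_seqP _).1 Ahy.1].
rewrite (rprod_off F ((C0_seqP _).1 hy.1)).
have hE : forall n, n \in F -> h n = v n by move=> n nF; rewrite /h /mix nF.
have -> : off F (fun n => nrm (h n)) = off F (fun n => nrm (g n)).
  by apply/funext => n; rewrite /off; case: ifP => // nF; rewrite /h /mix nF.
have -> : off F (fun n => nrm (A n (h n))) = off F (fun n => nrm (A n (g n))).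
  by apply/funext => n; rewrite /off; case: ifP => // nF; rewrite /h /mix nF.
have -> : \prod_(n <- F) nrm (A n (h n)) = \prod_(n <- F) nrm (A n (v n)).
  by rewrite big_seq [RHS]big_seq; apply: eq_bigr => n /hE ->.
rewrite mulrC => /le_trans; apply; rewrite ler_wpM2l//.
rewrite -[leRHS]mul1r ler_wpM2r//.
  by apply: rprod_ge0; [exact: summable_off|exact: off_ge0].
apply: (@le_trans _ _ (\prod_(n <- F) 1)); last by rewrite big1_eq.
rewrite big_seq [leRHS]big_seq; apply: ler_prod => n /hE ->.
by rewrite nrm_ge0 v1.
Qed.

Section well_defined.
Hypothesis M_summable : summable_seq (fun n => 1 - M n).
Hypothesis Ay : C0_equiv (fun n => A n (y n)) y.

Lemma factor_class h : C0_class y h -> C0_class y (fun n => A n (h n)).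
Proof.
move=> [h0 hy].
have Ay0 := C0_image factor_max_le max1_ge1 M_summable y_C0 Ay.
have [Ah0 AhAy] := C0_image_equiv factor_linear factor_max_le max1_ge1 M_summable y_C0 Ay0 h0 hy.
exact: (conj Ah0 (C0_equiv_trans Ah0 Ay0 y_C0 AhAy Ay)).
Qed.

Lemma tensor_op_exists : exists B, bounded_op V B /\
  forall h, C0_class y h -> B (tensor X h) = tensor X (fun n => A n (h n)).
Proof.
have [D D0 HD] := real_prod_bounded M_summable.
have aD F : \prod_(n <- F) a n <= D.
  apply: le_trans (le_trans (ler_norm _) (HD F)); apply: ler_prod => n _.
  by rewrite factor_norm_ge0 le_max lexx orbT.
have := @bounded_extension R X _ (C0_class y) (tensor X) (fun h => tensor X (fun n => A n (h n))) D (ltW D0).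
case=> [m c s sP|B [linB BE BD BV]].
  exact: (@factors_le _ _ X y A a y_C0 (@factor_linear) factor_norm_ge0 (@factor_norm_le)
    fset0 D m c s (fun F _ => aD F) sP (fun i => factor_class (sP i))).
exists B; split; last exact: BE.
apply: (bounded_opI _ linB BD) => x /BV.
apply: closure_subset => _ [m [c [s [sP ->]]]]; exists m, c, s; split=> // i.
by have [h hy <-] := sP i; exists (fun n => A n (h n)); first exact: factor_class.
Qed.

Section operator.
Variable B : X -> X.
Hypothesis B_bounded : bounded_op V B.
Hypothesis BA : forall h, C0_class y h -> B (tensor X h) = tensor X (fun n => A n (h n)).

Lemma tensor_op_le F1 (D : R) : 0 <= D -> (forall F, (F1 `<=` F)%fset ->
    \prod_(n <- F) a n <= D) ->
  forall x, V x -> nrm (B x) <= D * nrm x.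
Proof.
move=> D0 aD; apply: (bounded_op_le_closure B_bounded D0) => x [m [c [s [sP ->]]]].
have /choice[h hP] : forall i, exists h, C0_class y h /\ tensor X h = s i.
  by move=> i; have [h hy <-] := sP i; exists h.
have -> : \sum_(i < m) c i *: s i = \sum_(i < m) c i *: tensor X (h i).
  by apply: eq_bigr => i _; have [_ ->] := hP i.
have -> : B (\sum_(i < m) c i *: tensor X (h i)) =
    \sum_(i < m) c i *: tensor X (fun n => A n (h i n)).
  (* [B] is linear on [V] only, so membership in [V] is carried through the induction. *)
  have BVs k (d : 'I_k -> C) (f : 'I_k -> forall n, H n) : (forall i, C0_class y (f i)) ->
      V (\sum_(i < k) d i *: tensor X (f i)) /\ B (\sum_(i < k) d i *: tensor X (f i)) =
      \sum_(i < k) d i *: tensor X (fun n => A n (f i n)).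
    elim: k d f => [|k IH] d f fy.
      rewrite !big_ord0; split; first by case: subspace_incomplete.
      exact: bounded_op0 subspace_incomplete B_bounded.
    rewrite !big_ord_recl.
    have [] := IH (fun i => d (lift ord0 i)) (fun i => f (lift ord0 i)) (fun i => fy _).
    move=> VS BS; have Vt := tensor_in_class X (fy ord0).
    have [_ linV] := subspace_incomplete.
    split; first exact: (linV _ _ _ Vt VS).
    have [_ linB _] := B_bounded.
    by rewrite (linB _ _ _ Vt VS) BS (BA (fy ord0)).
  exact: (BVs _ c h (fun i => (hP i).1)).2.
exact: (@factors_le _ _ X y A a y_C0 (@factor_linear) factor_norm_ge0 (@factor_norm_le)
  F1 D m c h aD (fun i => (hP i).1) (fun i => factor_class (hP i).1)).
Qed.

(** Each finite product of the |A_n h_n| is at most [D] times that of the |h_n|, where [D] bounds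
    all finite products of the maxima. *)
Lemma C_seq_image0 h : uncond_prod (fun n => `|h n| : C) 0 ->
  uncond_prod (fun n => `|A n (h n)| : C) 0.
Proof.
move=> h0 sigma bij; apply/cvgn_nrmP => e e0.
have [D D0 HD] := real_prod_bounded M_summable.
have [N HN] := (cvgn_nrmP _ _).1 (h0 _ bij) _ (divr_gt0 e0 D0).
exists N => n /HN; rewrite !subr0 !nrm_prod => Hn.
have nn (k : nat) (x : H k) : nrm (`|x| : C) = nrm x.
  by rewrite nrmE nrm_real ger0_norm ?nrm_ge0.
apply: (@le_trans _ _ (\prod_(i < n) (M (sigma i) * nrm (`|h (sigma i)| : C)))).
  by apply: ler_prod => i _; rewrite nrm_ge0 !nn; exact: factor_max_le.
rewrite big_split /= -[leRHS](divfK (lt0r_neq0 D0)) mulrC ler_pM//.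
- by apply: prodr_ge0 => i _; exact: nrm_ge0.
- by apply: prodr_ge0 => i _; apply: le_trans ler01 (max1_ge1 _).
have [tau sK _] := bij.
have us : uniq [seq sigma i | i <- index_iota 0 n].
  by rewrite map_inj_uniq ?iota_uniq//; exact: can_inj sK.
have -> : \prod_(i < n) M (sigma i) =
    \prod_(k <- [seq sigma i | i <- index_iota 0 n]) M k by rewrite big_map big_mkord.
apply: le_trans (le_trans (ler_norm _) (HD [fset k in [seq sigma i | i <- index_iota 0 n]]%fset)).
rewrite le_eqVlt; apply/orP; left; apply/eqP; apply: perm_big; apply: uniq_perm.
- exact: us.
- exact: fset_uniq.
- by move=> k; rewrite inE.
Qed.

Lemma tensor_op_is_tensor_op : is_tensor_op y A B.
Proof.
split=> // h hC hV; have [h0|h0] := eqVneq (tensor X h) 0.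
  have Ah0 := C_seq_image0 ((tensor_eq0P X hC).1 h0).
  have AhC : C_seq (fun n => A n (h n)) by exists 0.
  have Ah := (tensor_eq0P X AhC).2 Ah0.
  rewrite Ah h0; split=> //; first by case: subspace_incomplete.
  exact: bounded_op0 subspace_incomplete B_bounded.
have hy := C0_class_of_tensor y_C0 hC hV h0.
have Ahy := factor_class hy.
by split; [exact: C0_C_seq Ahy.1|exact: tensor_in_class|exact: BA].
Qed.

(** With P the product of the norms over [F], b the norm of [B], and tails p, q within d of 1, the
    two estimates read b <= P (1 + d) and q P <= b p. Hence |P - b| <= d (b + D), which dictates d =
    e / (b + D). *)
Lemma opnorm_tensor_op : uncond_prod a (opnorm V B).
Proof.
set b := opnorm V B.
have b0 : 0 <= b := opnorm_ge0 subspace_incomplete B_bounded.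
have Bb := opnorm_le subspace_incomplete B_bounded; rewrite -/b in Bb.
have yy := C0_class_refl y_C0; have Ayy := factor_class yy.
have [D D0 HD] := real_prod_bounded M_summable.
have a_ge0 F : 0 <= \prod_(n <- F) a n.
  by apply: prodr_ge0 => n _; exact: factor_norm_ge0.
have aM F : \prod_(n <- F) a n <= \prod_(n <- F) M n.
  by apply: ler_prod => n _; rewrite factor_norm_ge0 le_max lexx orbT.
have aD F : \prod_(n <- F) a n <= D.
  exact: le_trans (aM F) (le_trans (ler_norm _) (HD F)).
apply: net_uncond_prod => e e0.
have K0 : 0 < b + D by lra.
have d0 : 0 < e / (b + D) by rewrite divr_gt0.
have [F1 HF1] := real_prod_tail M_summable d0.
have [F2 HF2] := rprod_tail ((C0_seqP _).1 yy.1) d0.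
have [F3 HF3] := rprod_tail ((C0_seqP _).1 Ayy.1) d0.
exists (F1 `|` F2 `|` F3)%fset => F; rewrite !fsubUset.
move=> /andP[/andP[F1F /HF2 H2] /HF3 H3].
have up : b <= \prod_(n <- F) a n * (1 + e / (b + D)).
  apply: opnorm_lub subspace_incomplete B_bounded _ _ => x Vx x1.
  have P0 : 0 <= \prod_(n <- F) a n * (1 + e / (b + D)).
    by rewrite mulr_ge0//; lra.
  apply: le_trans (tensor_op_le (F1 := F) P0 _ Vx) _; last first.
    by rewrite -[leRHS]mulr1 ler_wpM2l.
  move=> G FG; rewrite (prod_fset_split _ FG) ler_wpM2l//.
  apply: le_trans (aM _) _.
  have : [disjoint G `\` F & F1]%fset.
    apply/fdisjointP => n; rewrite !inE => /andP[nF _]; apply: contra nF.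
    exact: (fsubsetP F1F).
  by move=> /HF1; rewrite ler_norml => /andP[_]; lra.
have := tensor_op_lower F b0 Bb BA yy Ayy.
move: H2 H3 up; set p := rprod _; set q := rprod _; set P := \prod_(n <- F) _.
set d := e / _ => H2 H3 up low.
have PD : P <= D := aD F; have P0 : 0 <= P := a_ge0 F.
have eE : e = d * (b + D) by rewrite divfK ?gt_eqF.
move: H2 H3; rewrite !ler_norml => /andP[_ p1] /andP[q1 _].
have := ler_wpM2l b0 p1; have := ler_wpM2l P0 q1; have := ler_wpM2l (ltW d0) PD.
have := mulr_ge0 (ltW d0) b0; rewrite -/d eE.
by move: up low; clear; lra.
Qed.

End operator.
End well_defined.
End factor_operators.

(** * Strong limits, necessity and the semigroup *)

Section strong_limit.
Variables (R : realType) (H : nat -> hilbertType R) (X : complete_tensor H).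
Variables (y : forall n, H n) (A : forall n, H n -> H n) (B : X -> X).
Arguments A : clear implicits.
Local Notation V := (incomplete_tensor X y).
Local Notation M := (fun n => Num.max 1 (opnorm [set: H n] (A n))).
Hypothesis y_C0 : C0_seq y.
Hypothesis A_bounded : forall n, bounded_op [set: H n] (A n).
Hypothesis M_summable : summable_seq (fun n => 1 - M n).
Hypothesis Ay : C0_equiv (fun n => A n (y n)) y.
Hypothesis B_bounded : bounded_op V B.
Hypothesis BA : forall h, C0_class y h -> B (tensor X h) = tensor X (fun n => A n (h n)).

(** The existence theorem is applied to the family equal to [A n] on [F] and to the identity
    elsewhere. The bound [D] does not depend on [F], which strong convergence on the closure
    requires. *)
Lemma local_tensor_op_exists (F : {fset nat}) (D : R) : 0 <= D ->
  (forall G : {fset nat}, \prod_(n <- G) M n <= D) ->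
  exists BF, is_local_tensor_op y A F BF /\ forall x, V x -> nrm (BF x) <= D * nrm x.
Proof.
move=> D0 MD; pose AF n : H n -> H n := if n \in F then A n else id.
have AF_bounded n : bounded_op [set: H n] (AF n).
  by rewrite /AF; case: ifP => _ //; exact: bounded_op_id.
have AF_le n : opnorm [set: H n] (AF n) <= M n.
  rewrite /AF; case: ifP => _; first by rewrite le_max lexx orbT.
  apply: (@le_trans _ _ 1); last by rewrite le_max lexx.
  by apply: opnorm_lub (subspaceT _) (bounded_op_id _) _ _ => x.
have AF_summable : summable_seq (fun n => 1 - Num.max 1 (opnorm [set: H n] (AF n))).
  apply: (@summable_seqS _ _ _ 1) M_summable => n; rewrite mul1r.
  rewrite !ler0_norm ?subr_le0 ?le_max ?lexx// lerN2 lerD2l lerN2.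
  by rewrite ge_max AF_le le_max lexx.
have AFy : C0_equiv (fun n => AF n (y n)) y.
  have [|_] := @C0_class_modif _ _ y y (fun n => AF n (y n)) F (C0_class_refl y_C0); last by [].
  by move=> n /negbTE nF; rewrite /AF nF.
have [BF [BF_bounded BFA]] := tensor_op_exists X y_C0 AF_bounded AF_summable AFy.
exists BF; split.
  split; first exact: BF_bounded.
  move=> h h0 hy; rewrite (BFA _ (conj h0 hy)); congr tensor.
  by apply: functional_extensionality_dep => n; rewrite /AF; case: ifP.
apply: (@tensor_op_le _ _ X y AF y_C0 AF_bounded AF_summable AFy BF BF_bounded BFA fset0 D D0).
move=> G _; apply: le_trans (MD G); apply: ler_prod => n _.
by rewrite AF_le (opnorm_ge0 (subspaceT _) (AF_bounded n)).
Qed.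

Lemma tensor_op_is_strong_tensor_op : is_strong_tensor_op y A B.
Proof.
have [D D0 HD] := real_prod_bounded M_summable.
have MD (G : {fset nat}) : \prod_(n <- G) M n <= D := le_trans (ler_norm _) (HD G).
split; first exact: B_bounded.
have /choice[AF AFP] := fun F => local_tensor_op_exists F (ltW D0) MD.
exists AF; split=> [F|x Vx]; first by have [] := AFP F.
have fset_net_filter : Filter fset_net.
  apply: filter_from_filter; first by exists fset0.
  move=> F G _ _; exists (F `|` G)%fset => // K /=; rewrite fsubUset => /andP[FK GK].
  by split.
have BD := tensor_op_le y_C0 A_bounded M_summable Ay B_bounded BA (F1 := fset0) (ltW D0).
have {}BD : forall x, V x -> nrm (B x) <= D * nrm x.
  apply: BD => G _; apply: le_trans (MD G); apply: ler_prod => n _.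
  by rewrite (opnorm_ge0 (subspaceT _) (A_bounded n)) le_max lexx orbT.
have AFV F : bounded_op V (AF F) by have [[]] := AFP F.
have AFD F u : V u -> nrm (AF F u) <= D * nrm u by have [_] := AFP F; apply.
have sV : subspace V := subspace_incomplete X y.
(* The vectors of convergence. On a tensor the local operator yields exactly a mixed tensor, so
   [tensor_mix_cvg] applies; the uniform bound extends convergence from the span to [V]. *)
pose Q := [set u | V u /\ forall e : R, 0 < e -> exists F0 : {fset nat},
  forall F, (F0 `<=` F)%fset -> nrm (AF F u - B u) <= e].
have [V0 linV] := sV; have [_ linB _] := B_bounded.
have span_Q : lspan [set tensor X h | h in [set h | C0_seq h /\ C0_equiv h y]] `<=` Q.
  apply: lspan_ind => [|c u v _ [Vu Qu] [Vv Qv]|_ [h hy <-]].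
  - split=> // e e0; exists fset0 => F _.
    by rewrite (bounded_op0 sV (AFV F)) (bounded_op0 sV B_bounded) subrr nrm0 ltW.
  - split; first exact: linV.
    move=> e e0; have c1 : 0 < 1 + nrm c by apply: lt_le_trans ltr01 _; rewrite lerDl nrm_ge0.
    have [F1 HF1] := Qu _ (divr_gt0 (divr_gt0 e0 (ltr0Sn R 1)) c1).
    have [F2 HF2] := Qv _ (divr_gt0 e0 (ltr0Sn R 1)).
    exists (F1 `|` F2)%fset => F; rewrite fsubUset => /andP[/HF1 H1 /HF2 H2].
    have [_ linF _] := AFV F; rewrite (linF _ _ _ Vu Vv) (linB _ _ _ Vu Vv).
    rewrite opprD addrACA -scalerBr; apply: le_trans (nrmD _ _) _; rewrite nrmZ.
    have : nrm c * nrm (AF F u - B u) <= (1 + nrm c) * (e / 2 / (1 + nrm c)).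
      by rewrite ler_pM ?nrm_ge0// lerDr.
    by rewrite [(1 + nrm c) * _]mulrC divfK ?gt_eqF//; lra.
  - split; first exact: tensor_in_class.
    move=> e e0; have Ah := factor_class y_C0 A_bounded M_summable Ay hy.
    have hAh := C0_class_equiv y_C0 hy Ah.
    have [F0 HF0] := tensor_mix_cvg X hy.1 Ah.1 hAh e0.
    exists F0 => F /HF0; rewrite (BA hy).
    by have [[_ AFt] _] := AFP F; rewrite (AFt h hy.1 hy.2).
apply/cvg_nrmP => e e0.
(* One error for convergence at [s], and [D] times the distance to [s] for each of [AF F] and
   [B]. *)
have K0 : 0 < 1 + 2 * D by lra.
have d0 : 0 < e / (1 + 2 * D) by rewrite divr_gt0.
have [s Ss xs] := (closure_nrmP _ _).1 Vx _ d0.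
have [Vs /(_ _ d0)[F0 HF0]] := span_Q _ Ss.
exists F0 => // F /HF0 Hs.
have Vxs := subspaceB sV Vx Vs.
have -> : AF F x - B x = (AF F (x - s) + (AF F s - B s)) - B (x - s).
  rewrite (bounded_opB (AFV F) Vx Vs) (bounded_opB B_bounded Vx Vs) opprB.
  by rewrite [_ - _ + (AF F s - _)]addrA subrK addrA subrK.
have H1 := AFD F _ Vxs; have H2 := BD _ Vxs.
apply: le_trans (nrmD _ _) _; rewrite nrmN.
have H3 := nrmD (AF F (x - s)) (AF F s - B s).
have H4 := ler_wpM2l (ltW D0) xs.
have : e = e / (1 + 2 * D) * (1 + 2 * D) by rewrite divfK ?gt_eqF.
by move: Hs H4; set d := e / _; lra.
Qed.

End strong_limit.

(** * Necessity of the conditions *)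

Section necessity.
Variables (R : realType) (H : nat -> hilbertType R) (X : complete_tensor H).
Variables (y : forall n, H n) (A : forall n, H n -> H n) (B : X -> X).
Arguments A : clear implicits.
Local Notation V := (incomplete_tensor X y).
Local Notation a := (fun n => opnorm [set: H n] (A n)).
Local Notation M := (fun n => Num.max 1 (opnorm [set: H n] (A n))).
Hypothesis y_C0 : C0_seq y.
Hypothesis A_bounded : forall n, bounded_op [set: H n] (A n).
Hypothesis B_tensor : is_tensor_op y A B.
Hypothesis B_neq0 : nonzero_op V B.

Lemma tensor_op_class h : C0_class y h -> B (tensor X h) = tensor X (fun n => A n (h n)).
Proof.
move=> hy; have [_ /(_ _ (C0_C_seq hy.1) (tensor_in_class X hy))] := B_tensor.
by case.
Qed.

Lemma nonzero_image_exists : exists h, [/\ C0_class y h, C0_class y (fun n => A n (h n)) &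
  0 < nrm (tensor X (fun n => A n (h n)))].
Proof.
have [B_bounded BA] := B_tensor; have [x Vx Bx] := B_neq0.
have [h hy Bh] : exists2 h, C0_class y h & B (tensor X h) != 0.
  apply: contrapT => /forall2NP noh; move/eqP: Bx; apply.
  apply: (bounded_op_vanish B_bounded) Vx => _ [h hy <-].
  by have [//|/negP] := noh h; rewrite negbK => /eqP.
rewrite (tensor_op_class hy) in Bh.
have [AhC Ahy _] := BA _ (C0_C_seq hy.1) (tensor_in_class X hy).
exists h; split; [exact: hy|exact: C0_class_of_tensor y_C0 AhC Ahy Bh|].
by rewrite lt_def nrm_eq0 Bh nrm_ge0.
Qed.

Lemma factors_nonzero n : nonzero_op [set: H n] (A n).
Proof.
have [h [_ Ahy Ah0]] := nonzero_image_exists; exists (h n) => //.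
apply: contraTneq Ah0 => Ahn; rewrite (nrm_tensor X Ahy.1) /rprod.
by rewrite (@qprod_eq0 _ _ n) ?Ahn ?nrm0// ltxx.
Qed.

Lemma factors_max1_summable : summable_seq (fun n => 1 - M n).
Proof.
have [h [hy Ahy Ah0]] := nonzero_image_exists.
have [B_bounded _] := B_tensor.
have hs := (C0_seqP _).1 hy.1; have Ahs := (C0_seqP _).1 Ahy.1.
have [D1 D10 HD1] := real_prod_bounded Ahs.
have [D2 D20 HD2] := real_prod_bounded hs.
have sV := subspace_incomplete X y.
have b0 := opnorm_ge0 sV B_bounded.
have low F := tensor_op_lower A_bounded F b0 (opnorm_le sV B_bounded) tensor_op_class hy Ahy.
move: b0 low; set b := opnorm V B => b0 low.
have a_ge0 n : 0 <= a n := factor_norm_ge0 A_bounded n.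
(* The norm of the image tensor is the product P over [F] times the tail p. Here [D1] bounds P, and
   [b * D2] bounds p times the product of the operator norms, [D2] bounding the tail of the
   |h_n|. *)
apply: (@summable_of_prod_le _ _ (b * D2 * D1 / nrm (tensor X (fun n => A n (h n))))).
  by move=> n; rewrite le_max lexx.
apply: prod_max1_le => // F; rewrite ler_pdivlMr// (nrm_tensor X Ahy.1) (rprod_off F Ahs).
set P := \prod_(n <- F) nrm _; set p := rprod _; set Q := \prod_(n <- F) _.
have P0 : 0 <= P by apply: prodr_ge0 => n _; exact: nrm_ge0.
have -> : Q * (P * p) = (p * Q) * P by ring.
have p0 : 0 <= p.
  by apply: rprod_ge0 => [|n]; [exact: summable_off|rewrite /off; case: ifP => // _; exact: nrm_ge0].
have Q0 : 0 <= Q by apply: prodr_ge0 => n _.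
apply: ler_pM => //; first exact: mulr_ge0.
  apply: le_trans (low F) _; rewrite ler_wpM2l//.
  apply: rprod_le_bound => [|G]; first exact: summable_off.
  have <- : \prod_(n <- (G `\` F)%fset) nrm (h n) = \prod_(n <- G) off F (fun n => nrm (h n)) n.
    rewrite (prod_fset_split _ (fsubsetIl G F)) [X in _ = X * _]big_seq [X in _ = X * _]big1 ?mul1r; last first.
      by move=> n; rewrite inE /off => /andP[_ ->].
    have -> : (G `\` (G `&` F) = G `\` F)%fset.
      by apply/fsetP => n; rewrite !inE; case: (n \in G) => //=; rewrite ?andbF ?andbT.
    by rewrite !big_seq; apply: eq_bigr => n; rewrite inE /off => /andP[/negbTE ->].
  exact: le_trans (ler_norm _) (HD2 _).
exact: le_trans (ler_norm _) (HD1 _).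
Qed.

(** [C0_image_equiv] is based at [h], whose image is known to be a C_0-sequence, and moves from
    there to [y]: A y ~ A h ~ y. *)
Lemma factors_equiv : C0_equiv (fun n => A n (y n)) y.
Proof.
have [h [[h0 hy] [Ah0 Ahy] _]] := nonzero_image_exists.
have [Ay0 AyAh] := C0_image_equiv (factor_linear A_bounded) (factor_max_le A_bounded) (max1_ge1 A)
  factors_max1_summable h0 Ah0 y_C0 (C0_equiv_sym hy).
exact: C0_equiv_trans Ay0 Ah0 y_C0 AyAh Ahy.
Qed.

End necessity.

(** Each zero contributes 1 to the sum of the |1 - |h_n||. *)
Lemma C0_finite_zeros (R : realType) (H : nat -> hilbertType R) (h : forall n, H n) :
  C0_seq h -> exists F : {fset nat}, forall n, n \notin F -> h n != 0.
Proof.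
move=> /C0_seqP hs; have e0 : 0 < 2^-1 :> R by lra.
have [F HF] := summable_seq_tail hs e0; exists F => n nF; apply/eqP => hn.
have := HF [fset n]%fset; rewrite big_seq_fset1 hn nrm0 subr0 normr1 fdisjoint1X => /(_ nF).
lra.
Qed.

(** The maxima are submultiplicative, and [A] maps the class of [y], where the image of [y] under
    [B] lies, into itself. *)
Lemma semigroup_conditionsD (R : realType) (H : nat -> hilbertType R)
    (y : forall n, H n) (A B AB : forall n, H n -> H n) : C0_seq y ->
  (forall n, bounded_op [set: H n] (A n)) -> (forall n, bounded_op [set: H n] (B n)) ->
  (forall n, bounded_op [set: H n] (AB n)) -> (forall n x, AB n x = A n (B n x)) ->
  summable_seq (fun n => 1 - Num.max 1 (opnorm [set: H n] (A n))) ->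
  summable_seq (fun n => 1 - Num.max 1 (opnorm [set: H n] (B n))) ->
  C0_equiv (fun n => A n (y n)) y -> C0_class y (fun n => B n (y n)) ->
  summable_seq (fun n => 1 - Num.max 1 (opnorm [set: H n] (AB n))) /\
  C0_class y (fun n => AB n (y n)).
Proof.
move=> y0 bA bB bAB ABE As Bs Ay By; split; last first.
  have -> : (fun n => AB n (y n)) = (fun n => A n (B n (y n))).
    by apply: functional_extensionality_dep => n; exact: ABE.
  exact (factor_class y0 bA As Ay By).
apply: (@summable_seqS _ _ _ 1) (summable_seqM As Bs) => n; rewrite mul1r.
have A1 : 1 <= Num.max 1 (opnorm [set: H n] (A n)) by rewrite le_max lexx.
have B1 : 1 <= Num.max 1 (opnorm [set: H n] (B n)) by rewrite le_max lexx.
have AB1 : 1 <= Num.max 1 (opnorm [set: H n] (A n)) * Num.max 1 (opnorm [set: H n] (B n)).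
  by rewrite -[leLHS]mulr1 ler_pM.
rewrite !ler0_norm ?subr_le0 ?le_max ?lexx// lerN2 lerD2l lerN2 ge_max AB1 /=.
apply: opnorm_lub (subspaceT _) (bAB n) _ _ => x _ x1; rewrite ABE.
apply: le_trans (factor_max_le bA _) _; apply: ler_wpM2l; first exact: le_trans ler01 A1.
apply: le_trans (factor_max_le bB _) _; rewrite -[leRHS]mulr1 ler_wpM2l//.
exact: le_trans ler01 B1.
Qed.

Theorem lemma6p10 (R : realType) (H : nat -> hilbertType R)
    (X : complete_tensor H) (y : forall n, H n) (T : forall n, R -> H n -> H n)
    (y_C0 : C0_seq y) (T_semigroup : forall n, semigroup [set: H n] (T n)) :
  let V := incomplete_tensor X y in
  let cond (t : R) :=
    [/\ forall n, nonzero_op [set: H n] (T n t),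
        exists a : R,
          uncond_prod (fun n => Num.max 1 (opnorm [set: H n] (T n t))) a &
        abs_summable (fun n => 1 - inner (T n t (y n)) (y n))] in
  ((exists S : R -> X -> X,
      (forall t, 0 <= t -> is_tensor_op y (fun n => T n t) (S t)) /\
      nonzero_semigroup V S) <->
   (exists2 tau : R, 0 < tau & forall t, 0 <= t <= tau -> cond t)) /\
  (forall tau : R, 0 < tau -> (forall t, 0 <= t <= tau -> cond t) ->
   forall t, 0 < t ->
     [/\ exists B : X -> X,
           [/\ is_tensor_op y (fun n => T n t) B,
               is_strong_tensor_op y (fun n => T n t) B &
               uncond_prod (fun n => opnorm [set: H n] (T n t)) (opnorm V B)],
         C0_seq (fun n => T n t (y n)) &
         C0_equiv (fun n => T n t (y n)) y]).
Proof.
move=> V cond.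
have T_bounded n t : 0 <= t -> bounded_op [set: H n] (T n t) by case: (T_semigroup n) => + _ _; exact.
have T_add n s t x : 0 <= s -> 0 <= t -> T n (s + t) x = T n s (T n t x).
  by move=> s0 t0; case: (T_semigroup n) => _ _ /(_ s t s0 t0 x); exact.
pose M t n := Num.max 1 (opnorm [set: H n] (T n t)).
(* Only what survives composition: a product of nonzero operators may vanish. *)
pose D t := summable_seq (fun n => 1 - M t n) /\ C0_class y (fun n => T n t (y n)).
have cond_D t : 0 <= t -> cond t -> D t.
  move=> t0 [_ [p Mp] Ty].
  have Ms := summable_of_uncond_prod (max1_ge1 (fun n => T n t)) Mp.
  have bT n := T_bounded n t t0.
  split; first exact: Ms.
  exact: (conj (C0_image (factor_max_le bT) (max1_ge1 (fun n => T n t)) Ms y_C0 Ty) Ty).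
have D_add s t : 0 <= s -> 0 <= t -> D s -> D t -> D (s + t).
  move=> s0 t0 [Ms [_ Ty]] [Mt Tyt].
  apply: (semigroup_conditionsD y_C0 (fun n => T_bounded n s s0) (fun n => T_bounded n t t0)
    (fun n => T_bounded n _ (addr_ge0 s0 t0)) _ Ms Mt Ty Tyt).
  by move=> n x; exact: T_add.
have D_all tau : 0 < tau -> (forall t, 0 <= t <= tau -> cond t) -> forall t, 0 <= t -> D t.
  move=> tau0 condt.
  have Dk k : forall t, 0 <= t <= k%:R * tau -> D t.
    elim: k => [|k IH] t /andP[t0].
      rewrite mul0r => t1; apply: cond_D => //; apply: condt; rewrite t0.
      exact: le_trans t1 (ltW tau0).
    case: (leP t tau) => [tt _|tt tk]; first by apply: cond_D => //; apply: condt; rewrite t0.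
    have -> : t = tau + (t - tau) by rewrite addrC subrK.
    apply: D_add; [exact: ltW|by rewrite subr_ge0 ltW| |].
      by apply: cond_D; [exact: ltW|apply: condt; rewrite ltW /=].
    apply: IH; rewrite subr_ge0 (ltW tt) /=; move: tk; rewrite -[k.+1]addn1 natrD mulrDl mul1r.
    by rewrite lerBlDr.
  move=> t t0; apply: (Dk (Num.truncn (t / tau)).+1); rewrite t0 /=.
  by rewrite -ler_pdivrMr// ltW// truncnS_gt.
have op t : 0 <= t -> D t -> exists B : X -> X,
    [/\ bounded_op V B, is_tensor_op y (fun n => T n t) B,
        forall h, C0_class y h -> B (tensor X h) = tensor X (fun n => T n t (h n)),
        is_strong_tensor_op y (fun n => T n t) B &
        uncond_prod (fun n => opnorm [set: H n] (T n t)) (opnorm V B)].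
  move=> t0 [Ms [_ Ty]]; have bT n := T_bounded n t t0.
  have [B [bB BT]] := tensor_op_exists X y_C0 bT Ms Ty.
  exists B; split; [exact: bB| |exact: BT| |].
  - exact (tensor_op_is_tensor_op y_C0 bT Ms Ty bB BT).
  - exact (tensor_op_is_strong_tensor_op y_C0 bT Ms Ty bB BT).
  - exact (opnorm_tensor_op y_C0 bT Ms Ty bB BT).
split; last first.
  move=> tau tau0 condt t t0; have Dt := D_all tau tau0 condt t (ltW t0).
  have [B [_ B1 _ B2 B3]] := op t (ltW t0) Dt.
  split; [by exists B|exact: Dt.2.1|exact: Dt.2.2].
split.
  move=> [S [S_tensor [[S_bounded S0 S_add] [tau tau0 Stau]]]].
  (* The time at which [S] is nonzero serves as tau, because S(tau) = S(t) S(tau - t) forces S(t) to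
     be nonzero for every earlier t. *)
  exists tau => // t /andP[t0 tt]; have bT n := T_bounded n t t0.
  have St : nonzero_op V (S t).
    have [x Vx Sx] := Stau; exists (S (tau - t) x).
      by have [SV _ _] := S_bounded (tau - t) ltac:(by rewrite subr_ge0); exact: SV.
    by rewrite -S_add ?subr_ge0// addrC subrK.
  split.
  - move=> n; exact: factors_nonzero y_C0 (S_tensor t t0) St n.
  - have Ms := factors_max1_summable y_C0 bT (S_tensor t t0) St.
    by exists (rprod (M t)); exact: rprod_uncond_prod Ms.
  - exact: factors_equiv y_C0 bT (S_tensor t t0) St.
move=> [tau tau0 condt]; have Dt := D_all tau tau0 condt.
have /choice[S HS] : forall t, exists B : X -> X, 0 <= t ->
    [/\ bounded_op V B, is_tensor_op y (fun n => T n t) B &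
    forall h, C0_class y h -> B (tensor X h) = tensor X (fun n => T n t (h n))].
  move=> t; have [t0|t0] := leP 0 t; last by exists id.
  by have [B [B1 B2 B3 _ _]] := op t t0 (Dt t t0); exists B => _; split.
exists S; split=> [t t0|]; first by have [] := HS t t0.
split; first split.
- by move=> t t0; have [] := HS t t0.
- move=> x Vx; have [b0 _ S0] := HS 0 (lexx 0).
  apply: (bounded_op_eq_closure b0 (bounded_op_id _) _ Vx) => _ [h hy <-].
  rewrite S0//; congr tensor; apply: functional_extensionality_dep => n.
  by case: (T_semigroup n) => _ T0 _; exact: T0.
- move=> s t s0 t0 x Vx; have [b1 _ S1] := HS _ (addr_ge0 s0 t0).
  have [b2 _ S2] := HS s s0; have [b3 _ S3] := HS t t0.
  (* Two bounded operators are compared on generating tensors; [S2] applies there because T(t) keeps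
     [h] in the class. *)
  apply: (bounded_op_eq_closure b1 (bounded_op_comp b2 b3) _ Vx) => _ [h hy <-].
  have [Mt [_ Ty]] := Dt t t0.
  have Th := factor_class y_C0 (fun n => T_bounded n t t0) Mt Ty hy.
  rewrite (S1 _ hy) (S3 _ hy) (S2 _ Th); congr tensor.
  by apply: functional_extensionality_dep => n; exact: T_add.
exists tau => //; have tau_ge0 := ltW tau0; have [bS _ ST] := HS tau tau_ge0.
have [Mt [Ty0 Ty]] := Dt tau tau_ge0.
have [T_neq0 _ _] : cond tau by apply: condt; rewrite tau_ge0 /=.
(* The image of [y] at time tau vanishes in finitely many places at most; putting [v n] there makes
   every factor of the image nonzero, hence the norm of its tensor positive. *)
pose v n : H n := xget 0 [set x | T n tau x != 0].
have Tv n : T n tau (v n) != 0.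
  by apply: (@xgetPex _ 0 [set x | T n tau x != 0]); have [x _ Tx] := T_neq0 n; exists x.
have [F HF] := C0_finite_zeros Ty0.
pose h := mix F v y.
have hy : C0_class y h := C0_class_modif (C0_class_refl y_C0) (@mix_out _ _ F v y).
have Th := factor_class y_C0 (fun n => T_bounded n tau tau_ge0) Mt Ty hy.
exists (tensor X h); first exact: tensor_in_class.
rewrite (ST _ hy) -nrm_eq0 (nrm_tensor X Th.1) gt_eqF//.
apply: rprod_gt0 => [|n]; first exact: (C0_seqP _).1 Th.1.
rewrite lt_def nrm_eq0 nrm_ge0 andbT /h /mix; case: ifPn => [_|nF]; first exact: Tv.
exact: HF.
Qed.
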